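(* Let $\mathcal{H}$ be a complex Hilbert space of finite dimension $d$, let $X$ be a compact Hausdorff space, let $\nu\in\mathrm{POVM}^1_{\mathcal{H}}(X)$ be a quantum probability measure, let $\mu=\frac1d\operatorname{Tr}\circ\nu$, and let $\psi,\psi_1,\psi_2:X\to\mathcal{B}(\mathcal{H})$ be ($\nu$-integrable) quantum random variables. Then the following assertions hold. (1) (Generalised linearity) $\mathbb{E}_\nu[\varrho_1\psi_1+\varrho_2\psi_2]=\varrho_1\mathbb{E}_\nu[\psi_1]+\varrho_2\mathbb{E}_\nu[\psi_2]$ for all $\varrho_1,\varrho_2\in\mathcal{B}(\mathcal{H})$ that commute with the range of $\mathrm{d}\nu/\mathrm{d}\mu$ (i.e. with every value of this function). (2) (Monotonicity) $\mathbb{E}_\nu[\psi]\in\mathcal{B}(\mathcal{H})_+$ if $\psi(x)\in\mathcal{B}(\mathcal{H})_+$ for $\mu$-almost all $x\in X$. (3) (Additivity) If $E,F\in\mathcal{O}(X)$ satisfy $E\cap F=\emptyset$, then $\mathbb{E}_\nu[\chi_{E\cup F}\psi]=\mathbb{E}_\nu[\chi_E\psi]+\mathbb{E}_\nu[\chi_F\psi]$. (4) (Finitely supported measures) If $\nu$ is supported on a finite set $\{x_1,\dots,x_n\}\subset X$, then $\mathbb{E}_\nu[\psi]=\sum_{j=1}^n h_j^{1/2}\psi(x_j)h_j^{1/2}$, where $h_j=\nu(\{x_j\})$ for $j=1,\dots,n$. (5) (Complete positivity) The map $\phi_\nu:C(X)\otimes\mathcal{B}(\mathcal{H})\to\mathcal{B}(\mathcal{H})$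 defined by $\phi_\nu(f)=\int_X f\,\mathrm{d}\nu$ is a unital completely positive linear map. (6) (Jensen's inequality) If $J\subset\mathbb{R}$ is an open interval containing a closed interval $[\alpha,\beta]$, and if $\psi(x)$ is selfadjoint with spectrum contained in $[\alpha,\beta]$ for every $x\in X$, then $\vartheta\left(\int_X\psi\,\mathrm{d}\nu\right)\le\int_X\vartheta\circ\psi\,\mathrm{d}\nu$ for every operator convex function $\vartheta:J\to\mathbb{R}$. (7) (Quantum expectation of constant functions) The linear map $\mathcal{E}_\nu:\mathcal{B}(\mathcal{H})\to\mathcal{B}(\mathcal{H})$ defined by $\mathcal{E}_\nu(z)=\int_X z\,\mathrm{d}\nu$, $z\in\mathcal{B}(\mathcal{H})$, is a unital quantum channel; hence $\mathbb{E}_\nu[\rho]$ is a state for every state $\rho$. (8) (Fixed points) The set $\mathcal{A}_\nu=\{z\in\mathcal{B}(\mathcal{H}):\mathbb{E}_\nu[z]=z\}$ is a unital C$^*$-subalgebra of $\mathcal{B}(\mathcal{H})$. (9) (Ergodic property) There exists a trace-preserving conditional expectation $\mathfrak{E}_\nu:\mathcal{B}(\mathcal{H})\to\mathcal{B}(\mathcal{H})$ with range $\mathcal{A}_\nu$ such that $$\lim_{N\to\infty}\frac1N\left(\mathcal{I}+\sum_{j=1}^{N-1}\underbrace{\mathcal{E}_\nu\circ\cdots\circ\mathcal{E}_\nu}_{j}\right)=\mathfrak{E}_\nu,$$ where $\mathcal{I}$ is the identity map on $\mathcal{B}(\mathcal{H})$.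
   Context: $\mathcal{O}(X)$ is the Borel $\sigma$-algebra of $X$; $\mathcal{B}(\mathcal{H})$ is the algebra of bounded operators on $\mathcal{H}$ and $\mathcal{B}(\mathcal{H})_+$ its cone of positive operators. A state (density operator) is a positive operator $\rho$ with $\operatorname{Tr}(\rho)=1$. A positive operator valued measure on $(X,\mathcal{O}(X))$ is a function $\nu:\mathcal{O}(X)\to\mathcal{B}(\mathcal{H})$ with $\nu(E)\in\mathcal{B}(\mathcal{H})_+$ for all $E$, $\nu(X)\ne0$, and $\nu(\bigcup_kE_k)=\sum_k\nu(E_k)$ ($\sigma$-weak convergence) for countable families of pairwise disjoint sets. $\mathrm{POVM}^1_{\mathcal{H}}(X)$ is the set of those with $\nu(X)=1$ (quantum probability measures). A quantum random variable is a function $\psi:X\to\mathcal{B}(\mathcal{H})$ such that $x\mapsto\operatorname{Tr}(\rho\psi(x))$ is Borel measurable for every state $\rho$. With $\mu=\frac1d\operatorname{Tr}\circ\nu$, the function $\mathrm{d}\nu/\mathrm{d}\mu:X\to\mathcal{B}(\mathcal{H})_+$ is the (quantum random variable) Radon-Nikodým derivative of $\nu$ with respect to $\mu$: $\nu(E)=\int_E\frac{\mathrm{d}\nu}{\mathrm{d}\mu}\,\mathrm{d}\mu$ for all $E\in\mathcal{O}(X)$ (entrywise integral). $\psi$ is $\nu$-integrable if for every state $\rho$ the function $\psi_\rho(x)=\operatorname{Tr}\left(\rho\left(\frac{\mathrm{d}\nu}{\mathrm{d}\mu}(x)\right)^{1/2}\psi(x)\left(\frac{\mathrm{d}\nu}{\mathrm{d}\mu}(x)\right)^{1/2}\right)$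 is $\mu$-integrable; then $\int_X\psi\,\mathrm{d}\nu$ is the unique operator with $\operatorname{Tr}(\rho\int_X\psi\,\mathrm{d}\nu)=\int_X\psi_\rho\,\mathrm{d}\mu$ for every state $\rho$, and $\mathbb{E}_\nu[\psi]=\int_X\psi\,\mathrm{d}\nu$. For $z\in\mathcal{B}(\mathcal{H})$, $\mathbb{E}_\nu[z]$ means the quantum expectation of the constant function with value $z$. $\chi_E$ is the indicator function of $E$; $C(X)$ is the C$^*$-algebra of continuous complex-valued functions on $X$, and $C(X)\otimes\mathcal{B}(\mathcal{H})$ is identified with the continuous functions $X\to\mathcal{B}(\mathcal{H})$. A unital quantum channel is a completely positive, trace-preserving, unital linear map. A conditional expectation on $\mathcal{B}(\mathcal{H})$ is a unital completely positive linear map $\mathcal{E}:\mathcal{B}(\mathcal{H})\to\mathcal{B}(\mathcal{H})$ with $\mathcal{E}\circ\mathcal{E}=\mathcal{E}$. A function $\vartheta:J\to\mathbb{R}$ is operator convex if $\vartheta((1-t)a+tb)\le(1-t)\vartheta(a)+t\vartheta(b)$ for all $t\in[0,1]$ and all selfadjoint operators $a,b$ with spectra in $J$ (functional calculus); $\vartheta\circ\psi$ is $x\mapsto\vartheta(\psi(x))$. *)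

(* Defs.v *)
From HB Require Import structures.
From mathcomp Require Import all_boot all_order all_algebra.
From mathcomp Require Import sesquilinear spectral complex.
From mathcomp Require Import all_classical all_reals all_analysis.

Set Implicit Arguments.
Unset Strict Implicit.
Unset Printing Implicit Defensive.

Import Order.TTheory GRing.Theory Num.Theory.
Import numFieldTopology.Exports numFieldNormedType.Exports.

Local Open Scope classical_set_scope.
Local Open Scope ring_scope.
Local Open Scope complex_scope.
Local Open Scope sesquilinear_scope.

(* R[i] with the topology of its modulus (numFieldNormedType only equips
   types that are syntactically sorts of number structures). *)
HB.instance Definition _ (R : realType) :=
  PseudoPointedMetric.copy R[i] (R[i])^o.
HB.instance Definition _ (R : realType) := NormedModule.copy R[i] (R[i])^o.

Notation borel T := (g_sigma_algebraType (@open T)).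

Definition Borel_set (X : ptopologicalType) (E : set X) : Prop :=
  (measurable : set (set (borel X))) E.

Definition Borel_fun (R : realType) (X : ptopologicalType) (f : X -> R[i]) :=
  measurable_fun [set: borel X] (f : borel X -> borel R[i]).

Section Operators.
Variables (R : realType) (d : nat).
Local Notation C := R[i].

(* [0 <= z] in C means that z is real and nonnegative, so a positive matrix is
   selfadjoint. *)
Definition psdmx n (A : 'M[C]_n) : Prop :=
  forall v : 'cV[C]_n, 0 <= (v ^t* *m A *m v) 0 0.

Definition loewner n (A B : 'M[C]_n) : Prop := psdmx (B - A).

Definition state (rho : 'M[C]_d) : Prop := psdmx rho /\ \tr rho = 1.

Definition spectrum_in n (A : 'M[C]_n) (S : set R) : Prop :=
  forall z : C, eigenvalue A z -> exists2 t : R, S t & z = t%:C.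

(* Functional calculus of a selfadjoint matrix, through its spectral
   decomposition A = P^-1 *m diag_mx a *m P with P unitary and a real. *)
Definition fcalc (g : R -> R) n (A : 'M[C]_n) : 'M[C]_n :=
  invmx (spectralmx A)
  *m diag_mx (\row_j (g (complex.Re (spectral_diag A 0 j)))%:C)
  *m spectralmx A.

Definition sqrtmx n (A : 'M[C]_n) : 'M[C]_n := fcalc Num.sqrt A.

Definition operator_convex (J : set R) (theta : R -> R) : Prop :=
  forall (n : nat) (t : R) (a b : 'M[C]_n), 0 <= t <= 1 ->
  a \is hermsymmx -> b \is hermsymmx ->
  spectrum_in a J -> spectrum_in b J ->
  loewner (fcalc theta ((1 - t)%:C *: a + t%:C *: b))
          ((1 - t)%:C *: fcalc theta a + t%:C *: fcalc theta b).

(* The k x k matrices over B(H) are identified with the operators on H^k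
   through block matrices. *)
Definition completely_positive (phi : 'M[C]_d -> 'M[C]_d) : Prop :=
  forall (k : nat) (A : 'I_k -> 'I_k -> 'M[C]_d),
  psdmx (\mxblock_(i < k, j < k) A i j) ->
  psdmx (\mxblock_(i < k, j < k) phi (A i j)).

(* An element of M_k(C(X, B(H))) = C(X, M_k(B(H))) is positive when all its
   values are. *)
Definition completely_positive_on_C (X : ptopologicalType)
    (phi : (X -> 'M[C]_d) -> 'M[C]_d) : Prop :=
  forall (k : nat) (F : 'I_k -> 'I_k -> X -> 'M[C]_d),
  (forall i j, continuous (F i j)) ->
  (forall x, psdmx (\mxblock_(i < k, j < k) F i j x)) ->
  psdmx (\mxblock_(i < k, j < k) phi (F i j)).

Definition unital (phi : 'M[C]_d -> 'M[C]_d) : Prop := phi 1%:M = 1%:M.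

Definition trace_preserving (phi : 'M[C]_d -> 'M[C]_d) : Prop :=
  forall z, \tr (phi z) = \tr z.

Definition unital_quantum_channel (phi : 'M[C]_d -> 'M[C]_d) : Prop :=
  [/\ linear phi, completely_positive phi, trace_preserving phi & unital phi].

Definition conditional_expectation (phi : 'M[C]_d -> 'M[C]_d) : Prop :=
  [/\ linear phi, unital phi, completely_positive phi & phi \o phi = phi].

Definition unital_Cstar_subalgebra (A : set 'M[C]_d) : Prop :=
  [/\ A 1%:M,
      forall (c : C) a b, A a -> A b -> A (c *: a + b),
      forall a b, A a -> A b -> A (a *m b),
      forall a, A a -> A (a ^t*)
    & closed A].

End Operators.

(* The values of a povm outside the Borel sets are irrelevant.  The sigma-weak
   topology of B(H) is given by the functionals tr (T *m _), T trace class, that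
   is, any T in finite dimension. *)
Record povm (R : realType) (d : nat) (X : ptopologicalType) := Povm {
  povm_fun :> set X -> 'M[R[i]]_d ;
  povm_ge0 : forall E, Borel_set E -> psdmx (povm_fun E) ;
  povm_neq0 : povm_fun setT <> 0 ;
  povm_sigma_additive : forall E : nat -> set X,
    (forall k, Borel_set (E k)) -> trivIset setT E ->
    forall T : 'M[R[i]]_d,
    (fun n => \tr (T *m \sum_(k < n) povm_fun (E k))) @ \oo -->
    \tr (T *m povm_fun (\bigcup_k E k)) }.

Section TraceMeasure.
Variables (R : realType) (d : nat) (X : ptopologicalType) (nu : povm R d X).

(* mu = (1/d) tr o nu; the value 0 off the Borel sets is a convention. *)
Definition trace_measure (E : set (borel X)) : \bar R :=
  if `[< measurable E >] then (d%:R^-1 * complex.Re (\tr (nu E)))%:E else 0%E.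

Lemma cvg_Re (u : nat -> R[i]) (l : R[i]) : u @ \oo --> l ->
  (fun n => complex.Re (u n)) @ \oo --> complex.Re l.
Proof.
move=> /cvgrPdist_lt ul; apply/cvgrPdist_lt => e e0.
have e0C : 0 < e%:C by rewrite ltcR.
near=> n; rewrite -ltcR.
apply: (@le_lt_trans _ _ `|l - u n|); last by near: n; exact: ul.
by rewrite -raddfB /= normc_ge_Re.
Unshelve. all: by end_near. Qed.

Lemma psdmx_tr_ge0 n (A : 'M[R[i]]_n) : psdmx A -> 0 <= \tr A.
Proof.
move=> A0; apply: sumr_ge0 => i _; have := A0 (delta_mx i 0).
rewrite -mulmxA -colE mxE (bigD1 i) //= big1 ?addr0.
  by rewrite !mxE !eqxx conjC1 mul1r.
by move=> j /negbTE ji; rewrite !mxE ji conjC0 mul0r.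
Qed.

Lemma povm_set0 : nu set0 = 0.
Proof.
apply/matrixP => i j; rewrite mxE.
have trd (A : 'M[R[i]]_d) : \tr (delta_mx j i *m A) = A i j.
  rewrite /mxtrace (bigD1 j) //= big1 ?addr0; last first.
    by move=> k /negbTE kj; rewrite mxE big1 // => l _; rewrite mxE kj mul0r.
  rewrite mxE (bigD1 i) //= big1 ?addr0 ?mxE ?eqxx ?mul1r //.
  by move=> k /negbTE ki; rewrite mxE ki andbF mul0r.
have tr0 : trivIset setT (fun _ : nat => set0 : set X).
  by apply/trivIsetP => *; rewrite set0I.
have := @povm_sigma_additive _ _ _ nu (fun=> set0) (fun=> measurable0) tr0
  (delta_mx j i).
rewrite bigcup0 // trd => h.
have h0 : (fun n => nu set0 i j *+ n) @ \oo --> nu set0 i j.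
  apply: cvg_trans h; apply: near_eq_cvg; near=> n.
  by rewrite trd sumr_const card_ord mulmxnE.
have hs : (fun n => nu set0 i j *+ n.+1) @ \oo --> nu set0 i j.
  by rewrite (cvg_shiftS (fun n => nu set0 i j *+ n)).
have := cvgB hs h0; rewrite subrr.
have -> : (fun n => nu set0 i j *+ n.+1) - (fun n => nu set0 i j *+ n) =
    fun=> nu set0 i j.
  by apply/funext => n; rewrite /GRing.add /= !fctE mulrS addrK.
move=> c0.
have c1 : (fun=> nu set0 i j) @ \oo --> nu set0 i j by exact: cvg_cst.
exact: (cvg_unique (@norm_hausdorff R[i] _) c1 (c0 _)).
Unshelve. all: by end_near. Qed.

Let trace_measure0 : trace_measure set0 = 0%E.
Proof.
by rewrite /trace_measure povm_set0 mxtrace0 mulr0; case: ifP.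
Qed.

Let trace_measure_ge0 E : (0 <= trace_measure E)%E.
Proof.
rewrite /trace_measure; case: asboolP => // mE.
rewrite lee_fin mulr_ge0 ?invr_ge0 //.
by have := psdmx_tr_ge0 (@povm_ge0 _ _ _ nu _ mE); rewrite lecE => /andP[].
Qed.

Let trace_measure_sigma_additive : semi_sigma_additive trace_measure.
Proof.
move=> F mF tF mUF.
rewrite {2}/trace_measure asboolT //.
have -> : (fun n => (\sum_(0 <= i < n) trace_measure (F i))%E) =
    EFin \o (fun n => d%:R^-1 *
      complex.Re (\tr (1%:M *m \sum_(k < n) nu (F k)))).
  apply/funext => n /=; rewrite mul1mx (raddf_sum (@mxtrace _ _)).
  rewrite (raddf_sum (@complex.Re R)) mulr_sumr big_mkord.
  by rewrite -sumEFin; apply: eq_bigr => k _; rewrite /trace_measure asboolT.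
apply: cvg_EFin; first by near=> n.
apply: cvgM; first exact: cvg_cst.
rewrite -[nu (\bigcup_n F n)]mul1mx.
exact/cvg_Re/(@povm_sigma_additive _ _ _ nu).
Unshelve. all: by end_near. Qed.

HB.instance Definition _ := isMeasure.Build _ (borel X) R trace_measure
  trace_measure0 trace_measure_ge0 trace_measure_sigma_additive.

End TraceMeasure.

Section ComplexIntegral.
Variables (R : realType) (X : ptopologicalType).
Variable mu : {measure set (borel X) -> \bar R}.

Definition cintegrable (D : set X) (f : X -> R[i]) : Prop :=
  mu.-integrable D (fun x => (complex.Re (f x))%:E) /\
  mu.-integrable D (fun x => (complex.Im (f x))%:E).

Definition cintegral (D : set X) (f : X -> R[i]) : R[i] :=
  (\int[mu]_(x in D) complex.Re (f x)) +i* (\int[mu]_(x in D) complex.Im (f x)).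

End ComplexIntegral.

Section QuantumExpectation.
Variables (R : realType) (d : nat) (X : ptopologicalType).
Local Notation C := R[i].

Definition quantum_random_variable (psi : X -> 'M[C]_d) : Prop :=
  forall rho, state rho -> Borel_fun (fun x => \tr (rho *m psi x)).

Variable nu : povm R d X.
Local Notation mu := (trace_measure nu).

(* The Radon-Nikodym derivative is only determined mu-almost everywhere; this
   says that h is a version of it. *)
Definition is_RN_derivative (h : X -> 'M[C]_d) : Prop :=
  [/\ forall x, psdmx (h x),
      quantum_random_variable h,
      forall i j, cintegrable mu setT (fun x => h x i j)
    & forall E, Borel_set E ->
      nu E = \matrix_(i, j) cintegral mu E (fun x => h x i j)].

Variable h : X -> 'M[C]_d.

(* Its mu-integral is tr (rho *m A), A the nu-integral of psi. *)
Definition compressed (psi : X -> 'M[C]_d) (rho : 'M[C]_d) (x : X) : C :=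
  \tr (rho *m sqrtmx (h x) *m psi x *m sqrtmx (h x)).

Definition nu_integrable (psi : X -> 'M[C]_d) : Prop :=
  quantum_random_variable psi /\
  forall rho, state rho -> cintegrable mu setT (compressed psi rho).

(* Only meaningful for psi nu-integrable (else possibly the default value 0). *)
Definition quantum_expectation (psi : X -> 'M[C]_d) : 'M[C]_d :=
  xget 0 [set A | forall rho, state rho ->
                  \tr (rho *m A) = cintegral mu setT (compressed psi rho)].

Definition channel (z : 'M[C]_d) : 'M[C]_d := quantum_expectation (fun=> z).

Definition fixed_points : set 'M[C]_d := [set z | channel z = z].

End QuantumExpectation.

Definition cesaro_mean (R : realType) (d : nat)
    (phi : 'M[R[i]]_d -> 'M[R[i]]_d) (N : nat) (z : 'M[R[i]]_d) : 'M[R[i]]_d :=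
  N%:R^-1 *: (z + \sum_(1 <= j < N) iter j phi z).

(* Main.v *)
Require Import Defs.
From HB Require Import structures.
From mathcomp Require Import all_boot all_order all_algebra.
From mathcomp Require Import sesquilinear spectral complex.
From mathcomp Require Import all_classical all_reals all_analysis.
From mathcomp Require Import measurable_realfun lra.

Set Implicit Arguments.
Unset Strict Implicit.
Unset Printing Implicit Defensive.

Import Order.TTheory GRing.Theory Num.Theory.
Import numFieldTopology.Exports numFieldNormedType.Exports.

Local Open Scope classical_set_scope.
Local Open Scope complex_scope.
Local Open Scope ring_scope.
Local Open Scope sesquilinear_scope.

(** The quantum expectation of a function [psi] is the integral, against the trace
    measure, of [sqrtmx (h x) *m psi x *m sqrtmx (h x)], where [h] is the
    Radon-Nikodym derivative.  The proof rests on one observation: an integral of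
    a function with values in a finite-dimensional space belongs to the convex
    cone generated by its values, without any closure ([integral_in_cone]).
    Applied to all entries of finitely many integrands at once, this yields
    finitely many points [x k] and matrices [a k], multiples of the square roots
    of [h (x k)], with [\sum_k a k *m a k = 1%:M] and
    [\sum_k a k *m psi (x k) *m a k] as the expectation of every [psi] in the
    family ([expectation_quadrature], [expectation_kraus]).  The points may
    moreover be required to lie in a given set of full measure.

    The assertions thereby become statements of matrix algebra.  Linearity,
    monotonicity, additivity and complete positivity are read off the finite sum.
    For a finitely supported measure the points are chosen in the support, and the
    quadrature of indicator functions identifies the weights.  Jensen's inequality
    is that of Hansen and Pedersen for finite families ([jensen_finite]), deduced
    from operator convexity by averaging over a symmetry ([jensen_isometry]).

    For constant functions the finite sum is a Kraus decomposition of the channel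
    by selfadjoint operators ([channel_kraus]).  Such a channel preserves the
    trace and is selfadjoint for the trace inner product; its fixed points are
    the commutant of the Kraus operators ([kraus_fixedP]), and every matrix is the
    sum of a fixed point and of some [w - kraus w], so that Cesaro means converge to
    the projection onto the fixed points along the range of [1 - kraus]
    ([ergodic_projection_cvg]).

    Integrability has two ingredients.  Bounded measurable functions are
    integrable since the integrand is dominated by the trace of the derivative
    ([nu_integrable_bounded]).  Measurability of matrix functions such as the
    square root of [h] or [fcalc theta (psi x)] holds for every Borel function of
    a measurable Hermitian matrix, because all Borel functions are reached from
    polynomials by algebraic operations and pointwise limits
    ([fcalc_measurable_Borel]); an operator convex function is Borel on an
    interval since its sublevel sets are intervals. *)

(** * Positive matrices and the functional calculus *)

Section Adjoint.
Variable C : numClosedFieldType.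

Lemma adjmxM m n p (A : 'M[C]_(m, n)) (B : 'M[C]_(n, p)) :
  (A *m B)^t* = B^t* *m A^t*.
Proof. by rewrite trmx_mul map_mxM. Qed.

Lemma adjmxD m n (A B : 'M[C]_(m, n)) : (A + B)^t* = A^t* + B^t*.
Proof. by rewrite linearD /= map_mxD. Qed.

Lemma adjmxB m n (A B : 'M[C]_(m, n)) : (A - B)^t* = A^t* - B^t*.
Proof. by rewrite linearB /= map_mxB. Qed.

Lemma adjmxZ m n c (A : 'M[C]_(m, n)) : (c *: A)^t* = c^* *: A^t*.
Proof. by rewrite linearZ /= map_mxZ. Qed.

Lemma adjmx_sum I (r : seq I) m n (A : I -> 'M[C]_(m, n)) :
  (\sum_(i <- r) A i)^t* = \sum_(i <- r) (A i)^t*.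
Proof.
elim: r => [|i r ih]; first by rewrite !big_nil trmx0 map_mx0.
by rewrite !big_cons adjmxD ih.
Qed.

Lemma adjmx1 n : (1%:M : 'M[C]_n)^t* = 1%:M.
Proof. by rewrite trmx1 map_mx1. Qed.

Lemma hermsymmxP n (A : 'M[C]_n) : reflect (A^t* = A) (A \is hermsymmx).
Proof.
by apply: (iffP (is_hermitianmxP _ _ _)); rewrite expr0 scale1r => /esym.
Qed.

(** Polarization with the coefficients 1 and i; over the reals the statement
    would fail for antisymmetric matrices. *)
Lemma quad_form_eq0 n (B : 'M[C]_n) :
  (forall v : 'cV[C]_n, (v^t* *m B *m v) 0 0 = 0) -> B = 0.
Proof.
move=> B0; pose e i : 'cV[C]_n := delta_mx i 0.
have eBe i j : ((e i)^t* *m B *m e j) 0 0 = B i j.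
  by rewrite trmx_delta map_delta_mx -rowE -colE !mxE.
have aE (M N : 'M[C]_1) : (M + N) 0 0 = M 0 0 + N 0 0 by rewrite mxE.
have zE c (M : 'M[C]_1) : (c *: M) 0 0 = c * M 0 0 by rewrite mxE.
have B2 c i j : c * B i j + c^* * B j i = 0.
  have := B0 (e i + c *: e j).
  rewrite adjmxD adjmxZ !(mulmxDl, mulmxDr) -!(scalemxAl, scalemxAr).
  rewrite !(aE, zE) !eBe.
  have := B0 (e i); have := B0 (e j); rewrite !eBe => -> ->.
  by rewrite !mulr0 add0r addr0 addrC.
apply/matrixP => i j; rewrite mxE.
have := B2 1 i j; rewrite conjC1 !mul1r => B1.
have := B2 'i i j; rewrite conjCi mulNr -mulrBr => /eqP.
rewrite mulf_eq0 (negbTE (neq0Ci _)) subr_eq0 => /eqP Bi.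
by move: B1; rewrite -Bi -mulr2n => /eqP; rewrite mulrn_eq0 => /eqP.
Qed.

Lemma mxtr_gram m n (V : 'M[C]_(m, n)) :
  \tr (V^t* *m V) = \sum_j \sum_i `|V i j| ^+ 2.
Proof.
apply: eq_bigr => j _; rewrite mxE; apply: eq_bigr => i _.
by rewrite !mxE normCKC.
Qed.

Lemma mxtr_gram_ge0 m n (V : 'M[C]_(m, n)) : 0 <= \tr (V^t* *m V).
Proof.
rewrite mxtr_gram; apply: sumr_ge0 => j _; apply: sumr_ge0 => i _.
by rewrite exprn_ge0.
Qed.

Lemma mxtr_gram_eq0 m n (V : 'M[C]_(m, n)) : \tr (V^t* *m V) = 0 -> V = 0.
Proof.
rewrite mxtr_gram => /eqP; rewrite psumr_eq0; last first.
  by move=> j _; apply: sumr_ge0 => i _; rewrite exprn_ge0.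
move=> /allP V0; apply/matrixP => i j; rewrite mxE.
have := V0 j (mem_index_enum _); rewrite psumr_eq0; last first.
  by move=> k _; rewrite exprn_ge0.
by move=> /allP /(_ i (mem_index_enum _)); rewrite expf_eq0 normr_eq0 => /eqP.
Qed.

End Adjoint.

Section Matrices.
Variable R : realType.
Local Notation C := R[i].

Lemma psdmx_adj n (A : 'M[C]_n) : psdmx A -> A^t* = A.
Proof.
move=> A0; apply/eqP; rewrite -subr_eq0; apply/eqP/quad_form_eq0 => v.
have -> : v^t* *m (A^t* - A) *m v = (v^t* *m A *m v)^t* - v^t* *m A *m v.
  by rewrite mulmxBr mulmxBl !adjmxM trmxCK mulmxA.
rewrite 3!mxE [X in _ + X]mxE.
by have /ger0_real/CrealP -> := A0 v; rewrite subrr.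
Qed.

Lemma psdmx_hermsym n (A : 'M[C]_n) : psdmx A -> A \is hermsymmx.
Proof. by move=> /psdmx_adj /hermsymmxP. Qed.

Lemma psdmx_congr m n (A : 'M[C]_m) (V : 'M[C]_(m, n)) :
  psdmx A -> psdmx (V^t* *m A *m V).
Proof. by move=> A0 v; rewrite !mulmxA -adjmxM -mulmxA; exact: A0. Qed.

Lemma psdmxD n (A B : 'M[C]_n) : psdmx A -> psdmx B -> psdmx (A + B).
Proof. by move=> A0 B0 v; rewrite mulmxDr mulmxDl mxE addr_ge0. Qed.

Lemma psdmxZ n c (A : 'M[C]_n) : 0 <= c -> psdmx A -> psdmx (c *: A).
Proof. by move=> c0 A0 v; rewrite -scalemxAr -scalemxAl mxE mulr_ge0. Qed.

Lemma psdmx0 n : psdmx (0 : 'M[C]_n).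
Proof. by move=> v; rewrite mulmx0 mul0mx mxE. Qed.

Lemma psdmx_sum (I : Type) (r : seq I) n (A : I -> 'M[C]_n) :
  (forall i, psdmx (A i)) -> psdmx (\sum_(i <- r) A i).
Proof.
move=> A0; elim: r => [|i r ih]; first by rewrite big_nil; exact: psdmx0.
by rewrite big_cons; apply: psdmxD; [exact: A0|exact: ih].
Qed.

Lemma psdmx1 n : psdmx (1%:M : 'M[C]_n).
Proof.
move=> v; rewrite mulmx1 mxE; apply: sumr_ge0 => i _.
by rewrite !mxE mulrC mul_conjC_ge0.
Qed.

Lemma psdmx_gram m n (V : 'M[C]_(m, n)) : psdmx (V^t* *m V).
Proof. by have := psdmx_congr V (@psdmx1 m); rewrite mulmx1. Qed.

(** A family of matrices that contains the positive ones and is stable under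
    linear combinations contains everything: matrix units are obtained from
    rank-one positive matrices by polarization. *)
Lemma psdmx_span n (P : 'M[C]_n -> Prop) :
  (forall A, psdmx A -> P A) -> (forall c A B, P A -> P B -> P (c *: A + B)) ->
  forall A, P A.
Proof.
move=> Ppsd Plin A.
have PZ c B : P B -> P (c *: B).
  by move=> PB; rewrite -[_ *: _]addr0; apply: Plin => //; exact/Ppsd/psdmx0.
have PB c B1 B2 : P B1 -> P B2 -> P (c *: B1 - B2).
  by move=> P1 P2; apply: Plin => //; rewrite -scaleN1r; exact: PZ.
rewrite [A]matrix_sum_delta.
elim/big_ind: _ => [|B1 B2 P1 P2|i _]; first exact/Ppsd/psdmx0.
  by rewrite -[B1]scale1r; exact: Plin.
elim/big_ind: _ => [|B1 B2 P1 P2|j _]; first exact/Ppsd/psdmx0.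
  by rewrite -[B1]scale1r; exact: Plin.
apply (PZ).
pose e k : 'cV[C]_n := delta_mx k 0.
have ee k l : e k *m (e l)^t* = delta_mx k l.
  by rewrite trmx_delta map_delta_mx mul_delta_mx.
have Pe (v : 'cV[C]_n) : P (v *m v^t*).
  by apply: Ppsd; rewrite -[v in v *m _]trmxCK; exact: psdmx_gram.
pose D := e i *m (e i)^t* + e j *m (e j)^t*.
have PD : P D by rewrite /D -[e i *m _]scale1r; exact: Plin.
(* the cross terms of a positive matrix of rank one *)
pose X c := (e i + c *: e j) *m (e i + c *: e j)^t* - D.
have PX c : P (X c) by rewrite /X -[_ *m _ in X in X - _]scale1r; exact: PB.
have XE c : c * c^* = 1 -> X c = c^* *: delta_mx i j + c *: delta_mx j i.
  move=> c1; rewrite /X /D adjmxD adjmxZ !(mulmxDl, mulmxDr).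
  rewrite -!(scalemxAl, scalemxAr) scalerA c1 scale1r !ee.
  apply/eqP; rewrite subr_eq [c *: _ + delta_mx j j]addrC addrACA.
  by apply/eqP; rewrite addrC.
have X1 : X 1 = delta_mx i j + delta_mx j i.
  by rewrite XE conjC1 ?mulr1 // !scale1r.
have Xi : 'i *: X 'i = delta_mx i j - delta_mx j i.
  rewrite XE conjCi; last by rewrite mulrN -expr2 sqrCi opprK.
  apply/matrixP => a b; rewrite ![in LHS]mxE ![in RHS]mxE.
  by rewrite mulrDr !mulrA mulrN -expr2 sqrCi opprK mul1r mulN1r.
have -> : delta_mx i j = 2^-1 *: ('i *: X 'i + X 1).
  rewrite X1 Xi addrACA addNr addr0; apply/matrixP => a b.
  rewrite [RHS]mxE [X in _ * X]mxE; apply: (canRL (mulKf _)).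
    by rewrite pnatr_eq0.
  by rewrite mulr_natl mulr2n.
exact/PZ/Plin.
Qed.

(** A positive matrix is a difference of two positive matrices of nonzero trace,
    [A + 1] and [1], each of which is a multiple of a state. *)
Lemma state_span n (P : 'M[C]_n -> Prop) : (0 < n)%N ->
  (forall A, state A -> P A) -> (forall c A B, P A -> P B -> P (c *: A + B)) ->
  forall A, P A.
Proof.
move=> n0 Pst Plin.
have Ptr A : psdmx A -> \tr A != 0 -> P A.
  move=> A0 trA; pose B := (\tr A)^-1 *: A.
  have stB : state B.
    split; last by rewrite linearZ /= mulVf.
    by apply: psdmxZ => //; rewrite invr_ge0; exact: psdmx_tr_ge0.
  have -> : A = (\tr A - 1) *: B + B.
    by rewrite scalerBl scale1r subrK scalerA divff // scale1r.
  by apply: Plin; exact: Pst.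
have n0' : 0 < n%:R :> C by rewrite ltr0n.
apply: psdmx_span => // A A0.
have -> : A = (-1) *: 1%:M + (A + 1%:M) by rewrite scaleN1r addrC addrK.
apply: Plin; apply: Ptr; first exact: psdmx1.
- by rewrite mxtrace1 gt_eqF.
- by apply: psdmxD; [exact: A0|exact: psdmx1].
- rewrite linearD /= mxtrace1 gt_eqF // ltr_wpDl //; exact: psdmx_tr_ge0.
Qed.

Lemma adj_spectralmx n (A : 'M[C]_n) : invmx (spectralmx A) = (spectralmx A)^t*.
Proof. exact/invmx_unitary/spectral_unitarymx. Qed.

Definition real_diag n (b : 'I_n -> R) : 'M[C]_n := diag_mx (\row_j (b j)%:C).

(** Eigenvalues in the order of the rows of [spectralmx], with multiplicity. *)
Definition spectrum n (A : 'M[C]_n) (j : 'I_n) : R :=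
  complex.Re (spectral_diag A 0 j).

Lemma fcalcE g n (A : 'M[C]_n) : fcalc g A =
  invmx (spectralmx A) *m real_diag (g \o spectrum A) *m spectralmx A.
Proof. by []. Qed.

Lemma spectral_diagE n (A : 'M[C]_n) : A \is hermsymmx ->
  diag_mx (spectral_diag A) = real_diag (spectrum A).
Proof.
move=> hA; congr diag_mx; apply/rowP => j; rewrite mxE RRe_real //.
exact: (mxOverP (hermitian_spectral_diag_real hA)).
Qed.

Lemma spectralE n (A : 'M[C]_n) : A \is hermsymmx ->
  A = invmx (spectralmx A) *m real_diag (spectrum A) *m spectralmx A.
Proof.
move=> hA; rewrite -spectral_diagE //.
exact/orthomx_spectralP/hermitian_normalmx.
Qed.

Lemma spectralmxE n (A : 'M[C]_n) : A \is hermsymmx ->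
  spectralmx A *m A = real_diag (spectrum A) *m spectralmx A.
Proof.
move=> hA; set P := spectralmx A; set D := real_diag _.
have -> : D *m P = P *m (invmx P *m D *m P).
  by rewrite -!mulmxA mulKVmx // spectral_unit.
by congr (P *m _); exact: spectralE.
Qed.

Lemma spectralmx_fcalc g n (A : 'M[C]_n) :
  spectralmx A *m fcalc g A = real_diag (g \o spectrum A) *m spectralmx A.
Proof. rewrite fcalcE -!mulmxA; apply: mulKVmx; exact: spectral_unit. Qed.

(** If the rows of [U] are left eigenvectors of [A], the functional calculus
    acts on each of them through its eigenvalue; [U] need not be square nor
    invertible. *)
Lemma fcalc_eigen g m n (A : 'M[C]_n) (U : 'M[C]_(m, n)) (b : 'I_m -> R) :
  A \is hermsymmx -> U *m A = real_diag b *m U ->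
  U *m fcalc g A = real_diag (g \o b) *m U.
Proof.
move=> hA UA; pose P := spectralmx A; have uP : P \in unitmx := spectral_unit A.
have UPA : U *m invmx P *m real_diag (spectrum A) = real_diag b *m (U *m invmx P).
  have -> : real_diag (spectrum A) = P *m A *m invmx P.
    by rewrite spectralmxE // mulmxK.
  by rewrite !mulmxA mulmxKV // UA.
have key : U *m invmx P *m real_diag (g \o spectrum A) =
    real_diag (g \o b) *m (U *m invmx P).
  apply/matrixP => i j; have /matrixP /(_ i j) := UPA.
  rewrite !mul_mx_diag !mul_diag_mx !mxE mulrC => /eqP.
  rewrite -subr_eq0 -mulrBl mulf_eq0 => /orP[|/eqP ->].
    by rewrite subr_eq0 => /eqP /complexI /= ->; rewrite mulrC.
  by rewrite mulr0 mul0r.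
by rewrite fcalcE -/P !mulmxA key -!mulmxA mulVmx // mulmx1.
Qed.

(** Commutation, unitary equivalence, block decompositions and compressions to
    invariant subspaces are all instances of an intertwining relation. *)
Lemma fcalc_intertwine g m n (A : 'M[C]_m) (B : 'M[C]_n) (V : 'M[C]_(m, n)) :
  A \is hermsymmx -> B \is hermsymmx -> A *m V = V *m B ->
  fcalc g A *m V = V *m fcalc g B.
Proof.
move=> hA hB AV; pose P := spectralmx A.
have uP : P \in unitmx := spectral_unit A.
have PVB : P *m V *m B = real_diag (spectrum A) *m (P *m V).
  by rewrite -mulmxA -AV !mulmxA spectralmxE.
have := fcalc_eigen g hB PVB => /(congr1 (mulmx (invmx P))).
by rewrite -!mulmxA mulKmx // fcalcE -/P -!mulmxA => ->.
Qed.

Lemma fcalc_herm g n (A : 'M[C]_n) : fcalc g A \is hermsymmx.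
Proof.
apply/hermsymmxP; rewrite fcalcE adj_spectralmx !adjmxM trmxCK mulmxA.
congr (_ *m _ *m _); apply/matrixP => i j; rewrite !mxE eq_sym.
by case: eqP => [->|_]; rewrite ?mulr1n ?mulr0n ?conjC0 // conj_Creal //
  complex_real.
Qed.

Lemma eq_fcalc f g n (A : 'M[C]_n) :
  (forall j, f (spectrum A j) = g (spectrum A j)) -> fcalc f A = fcalc g A.
Proof.
move=> fg; rewrite !fcalcE (_ : real_diag _ = real_diag (g \o spectrum A)) //.
by congr diag_mx; apply/rowP => j; rewrite !mxE /= fg.
Qed.

Lemma fcalc_id n (A : 'M[C]_n) : A \is hermsymmx -> fcalc id A = A.
Proof. by move=> hA; rewrite [RHS]spectralE. Qed.

Lemma real_diagM n (a b : 'I_n -> R) :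
  real_diag a *m real_diag b = real_diag (fun j => a j * b j).
Proof.
rewrite mulmx_diag; congr diag_mx; apply/rowP => j.
by rewrite !mxE rmorphM.
Qed.

Lemma fcalcM f g n (A : 'M[C]_n) :
  fcalc f A *m fcalc g A = fcalc (fun t => f t * g t) A.
Proof.
rewrite [in LHS]fcalcE -!mulmxA spectralmx_fcalc.
by rewrite [real_diag _ *m _]mulmxA real_diagM mulmxA.
Qed.

Lemma fcalcD f g n (A : 'M[C]_n) :
  fcalc f A + fcalc g A = fcalc (fun t => f t + g t) A.
Proof.
have dD : real_diag ((fun t => f t + g t) \o spectrum A) =
    real_diag (f \o spectrum A) + real_diag (g \o spectrum A).
  apply/matrixP => i j; rewrite !mxE /= rmorphD /=.
  by case: (i == j); rewrite ?mulr1n // !mulr0n addr0.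
by rewrite !fcalcE dD mulmxDr mulmxDl.
Qed.

Lemma fcalc_cst r n (A : 'M[C]_n) : fcalc (fun=> r) A = r%:C%:M.
Proof.
rewrite fcalcE; have -> : real_diag ((fun=> r) \o spectrum A) = r%:C%:M.
  by apply/matrixP => i j; rewrite !mxE.
by rewrite mul_mx_scalar -scalemxAl mulVmx ?spectral_unit // scalemx1.
Qed.

Lemma fcalc_comp f g n (A : 'M[C]_n) :
  fcalc f (fcalc g A) = fcalc (f \o g) A.
Proof.
have := fcalc_eigen f (fcalc_herm g A) (spectralmx_fcalc g A).
move=> /(congr1 (mulmx (invmx (spectralmx A)))).
rewrite mulKmx ?spectral_unit // => ->.
by rewrite fcalcE mulmxA.
Qed.

Lemma fcalc_entry g n (A : 'M[C]_n) i j : fcalc g A i j =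
  \sum_k (g (spectrum A k))%:C * ((spectralmx A k i)^* * spectralmx A k j).
Proof.
rewrite fcalcE adj_spectralmx mxE; apply: eq_bigr => k _.
by rewrite mul_mx_diag !mxE /= mulrAC mulrC.
Qed.

Lemma spectrumE n (A : 'M[C]_n) j : A \is hermsymmx ->
  (spectrum A j)%:C = (row j (spectralmx A) *m A *m (row j (spectralmx A))^t*) 0 0.
Proof.
move=> hA; set P := spectralmx A.
have <- : (P *m A *m P^t*) j j = (row j P *m A *m (row j P)^t*) 0 0.
  rewrite -row_mul mxE [RHS]mxE; apply: eq_bigr => k _.
  by rewrite [in RHS]mxE; congr (_ * _); rewrite !mxE.
rewrite spectralmxE // -mulmxA (unitarymxP (spectral_unitarymx A)) mulmx1.
by rewrite !mxE eqxx mulr1n.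
Qed.

Lemma eigenvalue_spectrum n (A : 'M[C]_n) j : A \is hermsymmx ->
  eigenvalue A (spectrum A j)%:C.
Proof.
move=> hA; apply/eigenvalueP; exists (row j (spectralmx A)).
  rewrite -row_mul spectralmxE // /real_diag; apply/rowP => k.
  by rewrite mxE mul_diag_mx [LHS]mxE [RHS]mxE !mxE.
apply/eqP => r0; have /unitarymxP /matrixP /(_ j j) := spectral_unitarymx A.
rewrite !mxE eqxx big1 => [/eqP|k _]; first by rewrite eq_sym oner_eq0.
by have /rowP /(_ k) := r0; rewrite !mxE => ->; rewrite mul0r.
Qed.

Lemma spectrum_inP n (A : 'M[C]_n) (S : set R) : A \is hermsymmx ->
  spectrum_in A S -> forall j, S (spectrum A j).
Proof.
move=> hA AS j; have [t St /complexI ->] := AS _ (eigenvalue_spectrum j hA).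
by [].
Qed.

Lemma psdmx_spectrum n (A : 'M[C]_n) j : psdmx A -> 0 <= spectrum A j.
Proof.
move=> A0; rewrite -lecR spectrumE ?psdmx_hermsym //.
by have := A0 ((row j (spectralmx A))^t*); rewrite trmxCK.
Qed.

(** The nonnegative function is the square of its square root. *)
Lemma psdmx_fcalc g n (A : 'M[C]_n) :
  (forall j, 0 <= g (spectrum A j)) -> psdmx (fcalc g A).
Proof.
move=> g0; have -> : fcalc g A = (fcalc (Num.sqrt \o g) A)^t* *m
                                 fcalc (Num.sqrt \o g) A.
  rewrite (hermsymmxP _ (fcalc_herm _ _)) fcalcM; apply: eq_fcalc => j /=.
  by rewrite -expr2 sqr_sqrtr.
exact: psdmx_gram.
Qed.

Lemma sqrtmx_psd n (A : 'M[C]_n) : psdmx (sqrtmx A).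
Proof. by apply: psdmx_fcalc => j; exact: sqrtr_ge0. Qed.

Lemma sqrtmx_adj n (A : 'M[C]_n) : (sqrtmx A)^t* = sqrtmx A.
Proof. exact/psdmx_adj/sqrtmx_psd. Qed.

Lemma sqrtmxK n (A : 'M[C]_n) : psdmx A -> sqrtmx A *m sqrtmx A = A.
Proof.
move=> A0; apply: etrans (fcalc_id (psdmx_hermsym A0)); rewrite /sqrtmx fcalcM.
by apply: eq_fcalc => j; rewrite -expr2 sqr_sqrtr // psdmx_spectrum.
Qed.

(** The matrix [B] intertwines [A] with itself. *)
Lemma sqrtmx_comm n (A B : 'M[C]_n) : psdmx A -> B *m A = A *m B ->
  B *m sqrtmx A = sqrtmx A *m B.
Proof.
by move=> /psdmx_hermsym hA BA; apply/esym/fcalc_intertwine.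
Qed.

Lemma sqrtmxZ n (r : R) (A : 'M[C]_n) : 0 <= r -> psdmx A ->
  sqrtmx (r%:C *: A) = (Num.sqrt r)%:C *: sqrtmx A.
Proof.
move=> r0 /psdmx_hermsym hA.
have hr c : c%:C *: A = fcalc ( *%R c) A.
  rewrite -[A in LHS]fcalc_id // -mul_scalar_mx -(fcalc_cst _ A) fcalcM.
  by apply: eq_fcalc.
rewrite hr /sqrtmx fcalc_comp -mul_scalar_mx -(fcalc_cst _ A) fcalcM.
by apply: eq_fcalc => j /=; rewrite sqrtrM.
Qed.

End Matrices.

(** * Complex-valued measurable and integrable functions *)

Section ComplexMeasurable.
Context d (T : measurableType d) (R : realType).
Local Notation C := R[i].
Local Notation Re := complex.Re.
Local Notation Im := complex.Im.

Lemma ReM (x y : C) : Re (x * y) = Re x * Re y - Im x * Im y.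
Proof. by case: x y => [a b] []. Qed.

Lemma ImM (x y : C) : Im (x * y) = Re x * Im y + Im x * Re y.
Proof. by case: x y => [a b] []. Qed.

Definition cmeasurable (f : T -> C) : Prop :=
  measurable_fun setT (fun x => Re (f x)) /\
  measurable_fun setT (fun x => Im (f x)).

Lemma cmeasurable_cst c : cmeasurable (fun=> c).
Proof. by split; exact: measurable_cst. Qed.

Lemma cmeasurableD f g : cmeasurable f -> cmeasurable g ->
  cmeasurable (fun x => f x + g x).
Proof.
move=> [f1 f2] [g1 g2]; split.
  by under eq_fun do rewrite raddfD; exact: measurable_funD.
by under eq_fun do rewrite raddfD; exact: measurable_funD.
Qed.

Lemma cmeasurableM f g : cmeasurable f -> cmeasurable g ->
  cmeasurable (fun x => f x * g x).
Proof.
move=> [f1 f2] [g1 g2]; split.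
  under eq_fun do rewrite ReM.
  by apply: measurable_funB; exact: measurable_funM.
under eq_fun do rewrite ImM.
by apply: measurable_funD; exact: measurable_funM.
Qed.

Lemma cmeasurable_sum I (r : seq I) (f : I -> T -> C) :
  (forall i, cmeasurable (f i)) -> cmeasurable (fun x => \sum_(i <- r) f i x).
Proof.
move=> mf; elim: r => [|i r ih].
  by under eq_fun do rewrite big_nil; exact: cmeasurable_cst.
by under eq_fun do rewrite big_cons; exact: cmeasurableD.
Qed.

Lemma cmeasurable_real (f : T -> R) : measurable_fun setT f ->
  cmeasurable (fun x => (f x)%:C).
Proof. by move=> mf; split => //=; exact: measurable_cst. Qed.

Definition mmeasurable m n (F : T -> 'M[C]_(m, n)) : Prop :=
  forall i j, cmeasurable (fun x => F x i j).

Lemma mmeasurable_cst m n (A : 'M[C]_(m, n)) : mmeasurable (fun=> A).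
Proof. by move=> i j; exact: cmeasurable_cst. Qed.

Lemma mmeasurableD m n (F G : T -> 'M[C]_(m, n)) : mmeasurable F ->
  mmeasurable G -> mmeasurable (fun x => F x + G x).
Proof.
by move=> mF mG i j; under eq_fun do rewrite mxE; exact: cmeasurableD.
Qed.

Lemma mmeasurableZ m n (f : T -> C) (F : T -> 'M[C]_(m, n)) :
  cmeasurable f -> mmeasurable F -> mmeasurable (fun x => f x *: F x).
Proof.
by move=> mf mF i j; under eq_fun do rewrite mxE; exact: cmeasurableM.
Qed.

Lemma mmeasurableM m n p (F : T -> 'M[C]_(m, n)) (G : T -> 'M[C]_(n, p)) :
  mmeasurable F -> mmeasurable G -> mmeasurable (fun x => F x *m G x).
Proof.
move=> mF mG i j; under eq_fun do rewrite mxE.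
by apply: cmeasurable_sum => k; exact: cmeasurableM.
Qed.

Lemma mmeasurable_tr n (F : T -> 'M[C]_n) : mmeasurable F ->
  cmeasurable (fun x => \tr (F x)).
Proof. by move=> mF; exact: cmeasurable_sum. Qed.

End ComplexMeasurable.

Section BorelFunction.
Variables (R : realType) (X : ptopologicalType).
Local Notation C := R[i].
Local Notation Re := complex.Re.
Local Notation Im := complex.Im.

Lemma normc_ge_Im (x : C) : `|Im x|%:C <= `|x|.
Proof.
by rewrite normc_def lecR -sqrtr_sqr ler_wsqrtr // lerDr sqr_ge0.
Qed.

Lemma normc_le_ReIm (x : C) : `|x| <= (`|Re x| + `|Im x|)%:C.
Proof.
rewrite normc_def lecR -[leRHS]ger0_norm ?addr_ge0 // -sqrtr_sqr ler_wsqrtr //.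
rewrite sqrrD !real_normK ?num_real // addrAC lerDl mulrn_wge0 //.
Qed.

Lemma continuous_Re : continuous (@complex.Re R).
Proof.
move=> z A /nbhs_ballP[e e0 eA]; apply/nbhs_ballP; exists e%:C.
  by rewrite /= ltcR.
move=> w zw; apply: eA; rewrite -ball_normE /= -raddfB -ltcR.
exact: le_lt_trans (normc_ge_Re _) zw.
Qed.

Lemma continuous_Im : continuous (@complex.Im R).
Proof.
move=> z A /nbhs_ballP[e e0 eA]; apply/nbhs_ballP; exists e%:C.
  by rewrite /= ltcR.
move=> w zw; apply: eA; rewrite -ball_normE /= -raddfB -ltcR.
exact: le_lt_trans (normc_ge_Im _) zw.
Qed.

Lemma Borel_fun_real (g : C -> R) (f : X -> C) : continuous g -> Borel_fun f ->
  measurable_fun [set: borel X] (g \o f : borel X -> R).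
Proof.
move=> cg mf; apply: (measurability _ (RGenOpens.measurableE R)).
move=> _ [_ [a [b ->]] <-]; rewrite setTI comp_preimage.
rewrite -[X in measurable X]setTI; apply: mf => //.
apply: sub_sigma_algebra; have /continuousP := cg; apply.
exact: interval_open.
Qed.

Lemma continuous_Borel (g : X -> R) : continuous g ->
  measurable_fun [set: borel X] (g : borel X -> R).
Proof.
move=> cg; apply: (measurability _ (RGenOpens.measurableE R)).
move=> _ [_ [a [b ->]] <-]; rewrite setTI.
apply: sub_sigma_algebra; have /continuousP := cg; apply.
exact: interval_open.
Qed.

Definition rational_box (q : rat * rat * rat) : set C :=
  [set z | `|Re z - ratr q.1.1| < ratr q.2 /\ `|Im z - ratr q.1.2| < ratr q.2].

(** Open sets of the plane are countable unions of rational squares, so that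
    measurability can be checked on real and imaginary parts. *)
Lemma open_rational_boxes (U : set C) : open U ->
  U = \bigcup_(q in [set q | rational_box q `<=` U]) rational_box q.
Proof.
move=> oU; apply/seteqP; split => [z Uz|z [q /= qU qz]]; last exact: qU.
have /nbhs_ballP[e] := open_nbhs_nbhs (conj oU Uz).
rewrite /= => e0 eU; pose r := Re e.
have r0 : 0 < r by move: e0; rewrite ltcE => /andP[].
have er : e = r%:C by rewrite RRe_real // gtr0_real.
(* a square of half-side s is contained in the ball of radius 4 s around each
   of its points *)
have [s] := rat_in_itvoo (divr_gt0 r0 (ltr0n R 4)).
rewrite in_itv /= => /andP[s0 s4].
have hs (x : R) : exists p : rat, `|x - ratr p| < ratr s.
  have [p] := @rat_in_itvoo R (x - ratr s) (x + ratr s) ltac:(by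
    rewrite ltrD2l (lt_trans _ s0) // oppr_lt0).
  rewrite in_itv /= => /andP[p1 p2]; exists p.
  by rewrite distrC ltr_distl p1.
have [p hp] := hs (Re z); have [p' hp'] := hs (Im z).
exists (p, p', s) => //= w [/= wp wp'].
apply: eU; apply: (@le_lt_trans _ _ (`|Re (z - w)| + `|Im (z - w)|)%:C).
  exact: normc_le_ReIm.
rewrite er ltcR !raddfB /=.
have d1 : `|Re z - Re w| < ratr s + ratr s.
  by rewrite (le_lt_trans (ler_distD (ratr p) _ _)) // ltrD // distrC.
have d2 : `|Im z - Im w| < ratr s + ratr s.
  by rewrite (le_lt_trans (ler_distD (ratr p') _ _)) // ltrD // distrC.
rewrite (lt_trans (ltrD d1 d2)) // -!mulr2n -mulrnA -mulr_natl.
by rewrite -ltr_pdivlMl // mulrC.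
Qed.

(** Reduces the measurability of complex functions, whose target carries the
    Borel sets of its norm topology, to the real case. *)
Lemma Borel_funP (f : X -> C) :
  Borel_fun f <-> cmeasurable (f : borel X -> C).
Proof.
split=> [mf|[mRe mIm]].
  split; first exact: (Borel_fun_real continuous_Re).
  exact: (Borel_fun_real continuous_Im).
apply: (@measurability _ _ (borel X) (borel C) _ _ (@open C)) => //.
move=> _ [U oU <-]; rewrite setTI (open_rational_boxes oU) preimage_bigcup.
rewrite bigcup_mkcond; apply: (@countable_bigcupT_measurable _ (borel X)).
  exact: countableP.
move=> q; case: ifPn => // _.
have mb (g : borel X -> R) p s : measurable_fun setT g ->
    measurable [set x | `|g x - p| < s].
  move=> mg; rewrite -[X in measurable X]setTI.
  apply: (@measurable_fun_ltr _ _ _ _ (fun x => `|g x - p|) (cst s)) => //.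
  by apply: measurableT_comp => //; exact: measurable_funB.
by apply: measurableI; exact: mb.
Qed.

End BorelFunction.

Section ComplexIntegral.
Variables (R : realType) (X : ptopologicalType).
Variable mu : {measure set (borel X) -> \bar R}.
Local Notation C := R[i].
Local Notation Re := complex.Re.
Local Notation Im := complex.Im.
Variable D : set X.
Hypothesis mD : Borel_set D.

Lemma eq_cintegrable (f g : X -> C) : f =1 g ->
  cintegrable mu D f -> cintegrable mu D g.
Proof. by move=> /funext ->. Qed.

Lemma cintegrable_lin c (f g : X -> C) :
  cintegrable mu D f -> cintegrable mu D g ->
  cintegrable mu D (fun x => c * f x + g x) /\
  cintegral mu D (fun x => c * f x + g x) =
    c * cintegral mu D f + cintegral mu D g.
Proof.
move=> [f1 f2] [g1 g2].
have iZ k (u : borel X -> R) : mu.-integrable D (EFin \o u) ->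
    mu.-integrable D (EFin \o (fun x => k * u x)).
  by move=> iu; exact: (@integrableZl _ (borel X) _ _ _ mD k _ iu).
have iD (u v : borel X -> R) : mu.-integrable D (EFin \o u) ->
    mu.-integrable D (EFin \o v) -> mu.-integrable D (EFin \o (fun x => u x + v x)).
  by move=> iu iv; exact: (@integrableD _ (borel X) _ _ _ mD _ _ iu iv).
have iB (u v : borel X -> R) : mu.-integrable D (EFin \o u) ->
    mu.-integrable D (EFin \o v) -> mu.-integrable D (EFin \o (fun x => u x - v x)).
  by move=> iu iv; exact: (@integrableB _ (borel X) _ _ _ mD _ _ iu iv).
have eRe : (fun x => Re (c * f x + g x)) =
    (fun x => (Re c * Re (f x) - Im c * Im (f x)) + Re (g x)).
  by apply/funext => x; rewrite raddfD /= ReM.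
have eIm : (fun x => Im (c * f x + g x)) =
    (fun x => (Re c * Im (f x) + Im c * Re (f x)) + Im (g x)).
  by apply/funext => x; rewrite raddfD /= ImM.
have h1 := iZ (Re c) _ f1; have h2 := iZ (Im c) _ f2.
have h3 := iZ (Re c) _ f2; have h4 := iZ (Im c) _ f1.
split.
  split.
    have -> : (fun x => (Re (c * f x + g x))%:E) =
      EFin \o (fun x => (Re c * Re (f x) - Im c * Im (f x)) + Re (g x)).
      by rewrite -eRe.
    by apply: iD => //; exact: iB.
  have -> : (fun x => (Im (c * f x + g x))%:E) =
    EFin \o (fun x => (Re c * Im (f x) + Im c * Re (f x)) + Im (g x)).
    by rewrite -eIm.
  by apply: (iD) => //; exact: iD.
rewrite /cintegral eRe eIm.
have h5 := iB _ _ h1 h2; have h6 := iD _ _ h3 h4.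
rewrite (@RintegralD _ (borel X) _ _ _ _ _ mD h5 g1).
rewrite (@RintegralD _ (borel X) _ _ _ _ _ mD h6 g2).
rewrite (@RintegralB _ (borel X) _ _ _ _ _ mD h1 h2).
rewrite (@RintegralD _ (borel X) _ _ _ _ _ mD h3 h4).
rewrite !(@RintegralZl _ (borel X) _ _ _ _ _ mD) //.
by apply/eqP; rewrite eq_complex /= !raddfD /= ReM ImM /= !eqxx.
Qed.

Lemma cintegrable0 : cintegrable mu D (fun=> 0) /\ cintegral mu D (fun=> 0) = 0.
Proof.
split; first by split; exact: integrable0.
by rewrite /cintegral /Rintegral integral0.
Qed.

Lemma cintegrable_sum (I : finType) (c : I -> C) (f : I -> X -> C) :
  (forall i, cintegrable mu D (f i)) ->
  cintegrable mu D (fun x => \sum_i c i * f i x) /\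
  cintegral mu D (fun x => \sum_i c i * f i x) =
    \sum_i c i * cintegral mu D (f i).
Proof.
move=> fi; elim: (index_enum I) => [|i r [ih1 ih2]].
  under eq_fun do rewrite big_nil.
  by have [h1 h2] := cintegrable0; rewrite big_nil.
under eq_fun do rewrite big_cons.
by have [h1 h2] := cintegrable_lin (c i) (fi i) ih1; rewrite big_cons h2 ih2.
Qed.

(** Entrywise integral. *)
Definition mintegral m n (F : X -> 'M[C]_(m, n)) : 'M[C]_(m, n) :=
  \matrix_(i, j) cintegral mu D (fun x => F x i j).

Lemma mintegral_tr n (F : X -> 'M[C]_n) (A : 'M[C]_n) :
  (forall i j, cintegrable mu D (fun x => F x i j)) ->
  cintegrable mu D (fun x => \tr (A *m F x)) /\
  cintegral mu D (fun x => \tr (A *m F x)) = \tr (A *m mintegral F).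
Proof.
move=> iF.
have trE (M : 'M[C]_n) :
    \tr (A *m M) = \sum_(p : 'I_n * 'I_n) A p.1 p.2 * M p.2 p.1.
  rewrite -(pair_bigA _ (fun i j => A i j * M j i)) /=.
  by apply: eq_bigr => i _; rewrite mxE.
have [h1 h2] := @cintegrable_sum _ (fun p => A p.1 p.2) (fun p x => F x p.2 p.1)
  (fun p => iF p.2 p.1).
rewrite trE; split; first by under eq_fun do rewrite trE.
by under eq_fun do rewrite trE; rewrite h2; apply: eq_bigr => p _; rewrite mxE.
Qed.

End ComplexIntegral.

(** * Measurability of the functional calculus *)

Lemma cvg_finsum (K : numFieldType) (V : normedModType K) (T : Type)
    (F : set_system T) (FF : Filter F) (I : finType) (u : I -> T -> V)
    (l : I -> V) :
  (forall i, u i x @[x --> F] --> l i) ->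
  \sum_i u i x @[x --> F] --> \sum_i l i.
Proof.
move=> ul; elim: (index_enum I) => [|i r ih].
  by under eq_fun do rewrite big_nil; rewrite big_nil; exact: cvg_cst.
under eq_fun do rewrite big_cons.
by rewrite big_cons; apply: cvgD; [exact: ul|exact: ih].
Qed.

Section BorelCalculus.
Context d (T : measurableType d) (R : realType) (n : nat).
Local Notation C := R[i].
Local Notation Re := complex.Re.
Local Notation Im := complex.Im.

(** The functions that preserve measurability contain the polynomials and are
    stable under algebraic operations, composition and pointwise limits; this
    is enough to contain all Borel functions. *)
Definition fcalc_measurable (g : R -> R) : Prop :=
  forall F : T -> 'M[C]_n, (forall x, F x \is hermsymmx) -> mmeasurable F ->
  mmeasurable (fun x => fcalc g (F x)).

Lemma fcalc_measurable_cst r : fcalc_measurable (fun=> r).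
Proof.
move=> F hF mF; under eq_fun do rewrite fcalc_cst.
exact: mmeasurable_cst.
Qed.

Lemma fcalc_measurable_id : fcalc_measurable id.
Proof. by move=> F hF mF; under eq_fun do rewrite fcalc_id //. Qed.

Lemma fcalc_measurableD f g : fcalc_measurable f -> fcalc_measurable g ->
  fcalc_measurable (fun t => f t + g t).
Proof.
move=> mf mg F hF mF; under eq_fun do rewrite -fcalcD.
by apply: mmeasurableD; [exact: mf|exact: mg].
Qed.

Lemma fcalc_measurableM f g : fcalc_measurable f -> fcalc_measurable g ->
  fcalc_measurable (fun t => f t * g t).
Proof.
move=> mf mg F hF mF; under eq_fun do rewrite -fcalcM.
by apply: mmeasurableM; [exact: mf|exact: mg].
Qed.

Lemma fcalc_measurable_comp f g : fcalc_measurable f -> fcalc_measurable g ->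
  fcalc_measurable (f \o g).
Proof.
move=> mf mg F hF mF; under eq_fun do rewrite -fcalc_comp.
by apply: mf; [move=> x; exact: fcalc_herm|exact: mg].
Qed.

Lemma fcalc_measurable_sum I (r : seq I) (f : I -> R -> R) :
  (forall i, fcalc_measurable (f i)) ->
  fcalc_measurable (fun t => \sum_(i <- r) f i t).
Proof.
move=> mf; elim: r => [|i r ih].
  by under eq_fun do rewrite big_nil; exact: fcalc_measurable_cst.
under eq_fun do rewrite big_cons.
by apply: fcalc_measurableD; [exact: mf|exact: ih].
Qed.

Lemma fcalc_measurableX f k : fcalc_measurable f ->
  fcalc_measurable (fun t => f t ^+ k).
Proof.
move=> mf; elim: k => [|k ih]; first exact: fcalc_measurable_cst.
under eq_fun do rewrite exprS.
by apply: fcalc_measurableM; [exact: mf|exact: ih].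
Qed.

(** Entrywise, the functional calculus is a finite combination of the values
    of the function on the spectrum, so pointwise convergence suffices. *)
Lemma fcalc_measurable_lim (f : nat -> R -> R) g :
  (forall k, fcalc_measurable (f k)) -> (forall t, f ^~ t @ \oo --> g t) ->
  fcalc_measurable g.
Proof.
move=> mf fg F hF mF i j.
pose c x k := (spectralmx (F x) k i)^* * spectralmx (F x) k j.
have ReE h x : Re (fcalc h (F x) i j) =
    \sum_k h (spectrum (F x) k) * Re (c x k).
  rewrite fcalc_entry (raddf_sum (@complex.Re R)); apply: eq_bigr => k _.
  by rewrite /= ReM mul0r subr0.
have ImE h x : Im (fcalc h (F x) i j) =
    \sum_k h (spectrum (F x) k) * Im (c x k).
  rewrite fcalc_entry (raddf_sum (@complex.Im R)); apply: eq_bigr => k _.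
  by rewrite /= ImM mul0r addr0.
split.
  apply: (measurable_fun_cvg (h := fun k x => Re (fcalc (f k) (F x) i j))).
    by move=> k; have [] := mf k F hF mF i j.
  move=> x _; under eq_fun do rewrite ReE.
  by rewrite ReE; apply: cvg_finsum => k; exact: cvgMr_tmp.
apply: (measurable_fun_cvg (h := fun k x => Im (fcalc (f k) (F x) i j))).
  by move=> k; have [] := mf k F hF mF i j.
move=> x _; under eq_fun do rewrite ImE.
by rewrite ImE; apply: cvg_finsum => k; exact: cvgMr_tmp.
Qed.

Lemma fcalc_measurable_exp : fcalc_measurable expR.
Proof.
apply: (@fcalc_measurable_lim (fun k t => series (exp_coeff t) k)).
  move=> k; rewrite /series /=; apply: fcalc_measurable_sum => m.
  apply: fcalc_measurableM; last exact: fcalc_measurable_cst.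
  by apply: fcalc_measurableX; exact: fcalc_measurable_id.
by move=> t; exact: is_cvg_series_exp_coeff.
Qed.

(** The indicator of the positive half-line is reached from polynomials by two
    pointwise limits, through exp(- exp(- k t)), which tends to 1, e^-1 or 0
    according to the sign of t. *)
Lemma fcalc_measurable_pos : fcalc_measurable \1_[set t | 0 < t].
Proof.
pose w (t : R) : R := if 0 < t then 1 else if t == 0 then expR (- 1) else 0.
have mw : fcalc_measurable w.
  apply: (@fcalc_measurable_lim (fun k t => expR (- expR (- t) ^+ k))).
    move=> k; have mN f : fcalc_measurable f -> fcalc_measurable (fun t => - f t).
      move=> mf; under eq_fun do rewrite -mulN1r.
      by apply: fcalc_measurableM; [exact: fcalc_measurable_cst|exact: mf].
    apply: (fcalc_measurable_comp fcalc_measurable_exp).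
    apply: (mN); apply: fcalc_measurableX.
    apply: (fcalc_measurable_comp fcalc_measurable_exp).
    by apply: mN; exact: fcalc_measurable_id.
  move=> t; rewrite /w; case: ltP => [t0|].
    have lt1 : `|expR (- t)| < 1.
      by rewrite ger0_norm ?expR_ge0 // expR_lt1 oppr_lt0.
    rewrite -[X in _ --> X](@expR0 R) -oppr0.
    by apply: (cvg_comp _ _ (cvgN (cvg_expr lt1))); exact: continuous_expR.
  rewrite le_eqVlt => /predU1P[->|t0].
    rewrite eqxx oppr0 expR0; under eq_fun do rewrite expr1n.
    exact: cvg_cst.
  rewrite (lt_eqF t0).
  have lt1 : `|expR t| < 1 by rewrite ger0_norm ?expR_ge0 // expR_lt1.
  apply: (squeeze_cvgr _ (cvg_cst 0) (cvg_expr lt1)).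
  apply: nearW => k; rewrite expR_ge0 /=.
  have -> : expR t = (expR (- t))^-1 by rewrite expRN invrK.
  have y0 : 0 < expR (- t) ^+ k by rewrite exprn_gt0 // expR_gt0.
  rewrite exprVn; move: y0; set y := _ ^+ k => y0.
  rewrite expRN lef_pV2 ?posrE ?expR_gt0 //.
  by apply: le_trans (expR_ge1Dx _); rewrite lerDr.
have e1 : 1 - expR (- 1) != 0 :> R.
  by rewrite subr_eq0 gt_eqF // expR_lt1 oppr_lt0.
(* a quadratic polynomial that maps 1 to 1 and both e^-1 and 0 to 0 *)
have -> : \1_[set t | 0 < t] =
    (fun t => w t * (w t + - expR (- 1)) * (1 - expR (- 1))^-1) :> (R -> R).
  apply/funext => t; rewrite indicE /w.
  have -> : (t \in [set t | 0 < t]) = (0 < t) by apply/idP/idP; rewrite inE.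
  case: (ltP 0 t) => [_|_]; first by rewrite mul1r divff.
  by case: eqP; rewrite ?subrr ?mulr0 !mul0r.
apply: fcalc_measurableM; last exact: fcalc_measurable_cst.
apply: fcalc_measurableM; first exact: mw.
by apply: fcalc_measurableD; [exact: mw|exact: fcalc_measurable_cst].
Qed.

(** Half-lines are translates of the positive one, and the sets with a good
    indicator form a sigma-algebra. *)
Lemma fcalc_measurable_indic (A : set R) : measurable A ->
  fcalc_measurable \1_A.
Proof.
move=> mA; have {mA} : <<s @RGenOInfty.G R >> A.
  have e : (measurable : set (set R)) = <<s @RGenOInfty.G R >> :=
    RGenOInfty.measurableE R.
  by rewrite -e.
move: A; apply: smallest_sub; last first.
  move=> _ [c ->]; have -> : \1_`]c, +oo[%classic =
      (\1_[set t | 0 < t] \o (fun t => t + - c)) :> (R -> R).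
    apply/funext => t /=; rewrite !indicE; congr ((nat_of_bool _)%:R).
    by apply/idP/idP; rewrite !inE /= in_itv /= andbT subr_gt0.
  apply: (fcalc_measurable_comp fcalc_measurable_pos).
  by apply: fcalc_measurableD;
    [exact: fcalc_measurable_id|exact: fcalc_measurable_cst].
have mC (B : set R) : fcalc_measurable \1_B -> fcalc_measurable \1_(~` B).
  move=> mB; have -> : \1_(~` B) = (fun t => 1 + -1 * \1_B t) :> (R -> R).
    apply/funext => t; rewrite !indicE in_setC.
    by case: (t \in B); rewrite /= ?mulr1 ?mulr0 ?subrr ?addr0.
  apply: fcalc_measurableD; first exact: fcalc_measurable_cst.
  by apply: fcalc_measurableM; [exact: fcalc_measurable_cst|exact: mB].
split => [|B mB|F mF] /=.
- by rewrite indic0; exact: fcalc_measurable_cst.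
- by rewrite setTD; exact: mC.
- rewrite -[\bigcup_k F k]setCK setC_bigcup; apply: (mC).
  apply: (@fcalc_measurable_lim (fun k t => \prod_(i < k) \1_(~` F i) t)).
    elim=> [|k ih].
      by under eq_fun do rewrite big_ord0; exact: fcalc_measurable_cst.
    under eq_fun do rewrite big_ord_recr /=.
    by apply: fcalc_measurableM; [exact: ih|apply: mC; exact: mF].
  move=> t; rewrite indicE.
  case: (pselect ((\bigcap_k ~` F k) t)) => tF.
    rewrite mem_set // (_ : (fun k => _) = (fun=> 1)); first exact: cvg_cst.
    apply/funext => k; rewrite big1 // => i _.
    by rewrite indicE mem_set //; exact: tF.
  rewrite memNset //; have [m Fm] : exists m, F m t.
    by apply/not_existsP => Ft; apply: tF => i _; exact: Ft.
  apply: cvg_near_cst; exists m.+1 => // k /= mk.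
  apply/eqP; rewrite prodf_seq_eq0; apply/hasP; exists (Ordinal mk) => /=.
    by rewrite mem_index_enum.
  by rewrite indicE memNset //= => /(_ Fm).
Qed.

Import HBSimple.

Lemma fcalc_measurable_Borel (g : R -> R) : measurable_fun setT g ->
  fcalc_measurable g.
Proof.
move=> mg; have mEg : measurable_fun setT (EFin \o g).
  exact/measurable_EFinP.
have [s sg] := approximation_sfun measurableT mEg.
apply: (@fcalc_measurable_lim (fun k t => s k t)) => [k|t]; last first.
  by have /fine_cvgP[_] := sg t I.
have -> : s k = (fun t => \sum_(y <- finmap.enum_fset (fset_set (range (s k))))
    y * \1_(s k @^-1` [set y]) t) :> (R -> R).
  apply/funext => t; rewrite [LHS]fimfunE fsbig_finite //=.
apply: fcalc_measurable_sum => y; apply: fcalc_measurableM.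
  exact: fcalc_measurable_cst.
apply: fcalc_measurable_indic; exact: measurable_funPTI.
Qed.

End BorelCalculus.

(** * Convex cones and integrals *)

Section Cones.
Variable R : realType.

(** Hahn-Banach theorem in finite dimension, for a cone of pairs [(a, z)] that
    projects onto all [z].  One coordinate of [z] at a time is absorbed in [a],
    with the largest slope that keeps the last hypothesis true. *)
Lemma cone_linear_minorant n (K : R -> 'rV[R]_n -> Prop) :
  (forall a b z w, K a z -> K b w -> K (a + b) (z + w)) ->
  (forall t a z, 0 <= t -> K a z -> K (t * a) (t *: z)) ->
  (forall z, exists a, K a z) -> (forall a, K a 0 -> 0 <= a) ->
  exists l : 'cV[R]_n, forall a z, K a z -> (z *m l) 0 0 <= a.
Proof.
elim: n K => [|n ih] K KD KZ Kex K0.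
  by exists 0 => a z; rewrite mulmx0 mxE (thinmx0 z) => /K0.
pose e (t : R) : 'rV[R]_(1 + n) := row_mx t%:M 0.
have eD t u : e t + e u = e (t + u) by rewrite /e add_row_mx addr0 -raddfD.
have eZ t u : t *: e u = e (t * u).
  by rewrite /e scale_row_mx scaler0 scale_scalar_mx.
have e0 : e 0 = 0 by rewrite /e raddf0 row_mx0.
pose S := [set a | K a (e 1)].
have [a1 Ka1] := Kex (e 1); have [a2 Ka2] := Kex (e (- 1)).
have Slb : has_lbound S.
  exists (- a2) => a Sa; rewrite -subr_ge0 opprK; apply: K0.
  by rewrite -e0 -[in e 0](subrr 1) -eD; exact: KD.
have Sinf : has_inf S by split; first by exists a1.
pose s := inf S.
have Ke b t : K b (e t) -> s * t <= b.
  move=> Kb; have [t0|t0|t0] := ltgtP t 0.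
  - rewrite -ler_ndivrMr //; apply: lb_le_inf; first by exists a1.
    move=> c Sc; rewrite ler_ndivrMr // mulrC -subr_ge0 -mulNr; apply: K0.
    rewrite -e0 -[in e 0](subrr t) -eD; apply: KD => //.
    have t'0 : 0 <= - t by rewrite oppr_ge0 ltW.
    by have := KZ _ _ _ t'0 Sc; rewrite eZ mulr1.
  - rewrite -ler_pdivlMr //; apply: ge_inf => //.
    rewrite /S /= mulrC -(mulVf (lt0r_neq0 t0)) -eZ.
    by apply: KZ => //; rewrite invr_ge0 ltW.
  - by move: Kb; rewrite t0 mulr0 e0; exact: K0.
pose K' a z := exists t b, K b (row_mx t%:M z : 'rV_(1 + n)) /\ a = b - s * t.
have rD t u (z w : 'rV[R]_n) :
    row_mx t%:M z + row_mx u%:M w = row_mx (t + u)%:M (z + w) :> 'rV_(1 + n).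
  by rewrite add_row_mx -raddfD.
have [|||| l' l'P] := ih K'.
- move=> _ _ z w [t [b [Kb ->]]] [u [c [Kc ->]]].
  exists (t + u), (b + c); split; first by rewrite -rD; exact: KD.
  by rewrite mulrDr opprD addrACA.
- move=> t _ z t0 [u [c [Kc ->]]]; exists (t * u), (t * c); split.
    by rewrite -scale_scalar_mx -scale_row_mx; exact: KZ.
  by rewrite mulrBr mulrCA.
- by move=> z; have [a Ka] := Kex (row_mx 0%:M z); exists (a - s * 0), 0, a.
- by move=> _ [t [b [Kb ->]]]; rewrite subr_ge0; exact: Ke.
exists (col_mx s%:M l' : 'cV_(1 + n)) => a y Ky.
have yE : y = row_mx (lsubmx (y : 'rV_(1 + n)) 0 0)%:M
                     (rsubmx (y : 'rV_(1 + n))) :> 'rV_(1 + n).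
  by rewrite -mx11_scalar hsubmxK.
rewrite yE (@mul_row_col _ 1 1 n 1) -scalar_mxM mxE mxE eqxx mulr1n.
rewrite -lerBrDl; apply: l'P.
exists (lsubmx (y : 'rV_(1 + n)) 0 0), a; split; first by rewrite -yE.
by rewrite [s * _]mulrC.
Qed.

(** No closedness is required of the cone: either it projects onto a proper
    cone of the hyperplane forgetting a coordinate, or it lies on one side of
    the graph of a linear function of the other coordinates. *)
Lemma proper_cone_functional n (K : set 'rV[R]_n) p :
  K 0 -> (forall y z, K y -> K z -> K (y + z)) ->
  (forall t y, 0 <= t -> K y -> K (t *: y)) -> ~ K p ->
  exists2 c : 'cV[R]_n, c != 0 & forall y, K y -> 0 <= (y *m c) 0 0.
Proof.
elim: n K p => [|n ih] K p K0 KD KZ Kp.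
  by exfalso; apply: Kp; rewrite (thinmx0 p).
pose r (t : R) (z : 'rV[R]_n) : 'rV[R]_(1 + n) := row_mx t%:M z.
have rD t u z w : r t z + r u w = r (t + u) (z + w).
  by rewrite /r add_row_mx -raddfD.
have rZ t u z : t *: r u z = r (t * u) (t *: z).
  by rewrite /r scale_row_mx scale_scalar_mx.
have r0 : r 0 0 = 0 by rewrite /r raddf0 row_mx0.
have rE (y : 'rV[R]_(1 + n)) : y = r (lsubmx y 0 0) (rsubmx y).
  by rewrite /r -mx11_scalar hsubmxK.
have [[z Kz]|Kall] := pselect (exists z, ~ exists a, K (r a z)).
  have [|||c c0 cP] := ih [set z | exists a, K (r a z)] z _ _ _ Kz.
  - by exists 0; rewrite r0.
  - by move=> y w [a Ka] [b Kb]; exists (a + b); rewrite -rD; exact: KD.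
  - by move=> t y t0 [a Ka]; exists (t * a); rewrite -rZ; exact: KZ.
  exists (col_mx 0 c : 'cV_(1 + n)).
    by apply: contra c0 => /eqP h; rewrite -[c](col_mxKd (0 : 'cV_1)) h linear0.
  move=> y Ky; rewrite [y]rE (@mul_row_col _ 1 1 n 1) mulmx0 add0r; apply: cP.
  by exists (lsubmx (y : 'rV_(1 + n)) 0 0); rewrite -rE.
have {}Kall z : exists a, K (r a z).
  by apply: contrapT => h; apply: Kall; exists z.
(* the cone cannot contain both vertical directions *)
have [sg [sg1 Ksg]] : exists sg : R, sg * sg = 1 /\ ~ K (r (- sg) 0).
  apply: contrapT => h.
  have K1 : K (r (- 1) 0).
    by apply: contrapT => h1; apply: h; exists 1; rewrite mulr1.
  have K2 : K (r 1 0).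
    apply: contrapT => h1; apply: h; exists (- 1).
    by rewrite mulrNN mulr1 opprK.
  apply: Kp; rewrite [p]rE; set t := lsubmx _ _ _.
  have [a Ka] := Kall (rsubmx (p : 'rV_(1 + n))).
  have Kt u : K (r u 0).
    have [u0|u0] := leP 0 u.
      by rewrite -[u]mulr1 -(scaler0 _ u) -rZ; exact: KZ.
    have u'0 : 0 <= - u by rewrite oppr_ge0 ltW.
    by have := KZ _ _ u'0 K1; rewrite rZ scaler0 mulrNN mulr1.
  by rewrite -[t](subrK a) -[rsubmx _]add0r -rD; exact: KD.
have [|||| l lP] := @cone_linear_minorant n (fun b z => K (r (sg * b) z)).
- by move=> a b z w Ka Kb; rewrite mulrDr -rD; exact: KD.
- by move=> t a z t0 Ka; rewrite mulrCA -rZ; exact: KZ.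
- by move=> z; have [a Ka] := Kall z; exists (sg * a); rewrite mulrA sg1 mul1r.
- move=> a Ka; rewrite leNgt; apply/negP => a0; apply: Ksg.
  have -> : r (- sg) 0 = (- a^-1) *: r (sg * a) 0.
    by rewrite rZ scaler0 mulrCA mulNr mulVf ?lt_eqF // mulrN1.
  by apply: KZ => //; rewrite oppr_ge0 invr_le0 ltW.
exists (col_mx sg%:M (- l) : 'cV_(1 + n)).
  apply/eqP => /(congr1 (@usubmx _ 1 n 1)); rewrite col_mxKu linear0.
  move=> /matrixP/(_ 0 0); rewrite !mxE eqxx mulr1n => s0.
  by move: sg1; rewrite s0 mul0r => /eqP; rewrite eq_sym oner_eq0.
move=> y; rewrite [y]rE; move: (lsubmx _ _ _) (rsubmx _) => t z Ky.
rewrite /r (@mul_row_col _ 1 1 n 1) -scalar_mxM mulmxN mxE [X in _ + X]mxE.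
rewrite mxE eqxx mulr1n subr_ge0; apply: lP.
by rewrite mulrCA sg1 mulr1.
Qed.

Context d (T : measurableType d) (mu : {measure set T -> \bar R}).

(** The integral of a vector-valued function lies in the convex cone, closed or
    not, generated by its values.  Otherwise a linear functional separates them;
    composed with the function it vanishes almost everywhere, and one coordinate
    is redundant on the set where it does. *)
Lemma integral_in_cone n (D : set T) (f : 'I_n -> T -> R) : measurable D ->
  (forall j, mu.-integrable D (EFin \o f j)) ->
  exists m (lam : 'I_m -> R) (x : 'I_m -> T),
  [/\ forall k, 0 <= lam k, forall k, D (x k) &
      forall j, \int[mu]_(t in D) f j t = \sum_k lam k * f j (x k)].
Proof.
have no : 'I_0 -> T by case.
elim: n D f => [|n ih] D f mD fi.
  by exists 0, (fun=> 0), no; split; case.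
pose v t : 'rV[R]_n.+1 := \row_j f j t.
pose p : 'rV[R]_n.+1 := \row_j \int[mu]_(t in D) f j t.
pose K := [set y : 'rV[R]_n.+1 | exists m (lam : 'I_m -> R) (x : 'I_m -> T),
  [/\ forall k, 0 <= lam k, forall k, D (x k) & y = \sum_k lam k *: v (x k)]].
have [[m [lam [x [lam0 Dx pE]]]]|Kp] := pselect (K p).
  exists m, lam, x; split => // j; have /rowP/(_ j) := pE.
  rewrite mxE => ->; rewrite summxE; apply: eq_bigr => k _.
  by rewrite !mxE.
have K0 : K 0.
  by exists 0, (fun=> 0), no; split; [case|case|rewrite big_ord0].
have KD y z : K y -> K z -> K (y + z).
  move=> [m [lam [x [lam0 Dx ->]]]] [m' [lam' [x' [lam0' Dx' ->]]]].
  pose glue A (u : 'I_m -> A) (u' : 'I_m' -> A) k :=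
    match fintype.split k with inl i => u i | inr i => u' i end.
  exists (m + m')%N, (glue R lam lam'), (glue T x x'); rewrite /glue.
  split=> [k|k|]; [by case: fintype.split|by case: fintype.split|].
  rewrite big_split_ord /=; congr (_ + _); apply: eq_bigr => k _.
    by have -> : fintype.split (lshift m' k) = inl k := unsplitK (inl k).
  by have -> : fintype.split (rshift m k) = inr k := unsplitK (inr k).
have KZ t y : 0 <= t -> K y -> K (t *: y).
  move=> t0 [m [lam [x [lam0 Dx ->]]]]; exists m, (fun k => t * lam k), x.
  split=> // [k|]; first exact: mulr_ge0.
  by rewrite scaler_sumr; apply: eq_bigr => k _; rewrite scalerA.
have Kv t : D t -> K (v t).
  move=> Dt; exists 1, (fun=> 1), (fun=> t); split => //.
  by rewrite big_ord1 scale1r.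
(* adding the direction - p makes the functional nonpositive at p *)
pose K' := [set y | exists z t, [/\ K z, 0 <= t & y = z - t *: p]].
have [||||c c0 cP] := @proper_cone_functional n.+1 K' p.
- by exists 0, 0; split => //; rewrite scale0r subrr.
- move=> _ _ [z [t [Kz t0 ->]]] [w [u [Kw u0 ->]]].
  exists (z + w), (t + u); split; [exact: KD|exact: addr_ge0|].
  by rewrite scalerDl opprD addrACA.
- move=> u _ u0 [z [t [Kz t0 ->]]]; exists (u *: z), (u * t).
  by split; [exact: KZ|exact: mulr_ge0|rewrite scalerBr scalerA].
- move=> [z [t [Kz t0 pE]]]; apply: Kp.
  have t1 : 0 < 1 + t by rewrite ltr_wpDr.
  have -> : p = (1 + t)^-1 *: z.
    have -> : z = (1 + t) *: p.
      by rewrite scalerDl scale1r {1}pE subrK.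
    by rewrite scalerA mulVf ?scale1r // gt_eqF.
  by apply: KZ => //; rewrite invr_ge0 ltW.
pose g t := \sum_j c j 0 * f j t.
have gE t : (v t *m c) 0 0 = g t.
  by rewrite mxE; apply: eq_bigr => j _; rewrite mxE mulrC.
have g0 t : D t -> 0 <= g t.
  move=> Dt; rewrite -gE; apply: cP; exists (v t), 0.
  by split => //; [exact: Kv|rewrite scale0r subr0].
have gsum (E : set T) : measurable E -> E `<=` D ->
    mu.-integrable E (EFin \o g) /\
    \int[mu]_(t in E) g t = \sum_j c j 0 * \int[mu]_(t in E) f j t.
  move=> mE ED; have fiE j : mu.-integrable E (EFin \o f j).
    exact: (integrableS mD mE ED).
  rewrite /g; elim: (index_enum _) => [|j s [ih1 ih2]].
    rewrite big_nil (@eq_Rintegral _ _ _ _ _ (cst 0)); last first.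
      by move=> t _; rewrite big_nil.
    split; last by rewrite /Rintegral integral0.
    by apply: (eq_integrable mE (cst 0%E)); [move=> t _; rewrite /= big_nil|exact: integrable0].
  have iZ : mu.-integrable E (EFin \o (fun t => c j 0 * f j t)).
    exact: (integrableZl mE (c j 0) (fiE j)).
  split.
    apply: (eq_integrable mE _ _ _ (integrableD mE iZ ih1)) => t _ /=.
    by rewrite big_cons.
  rewrite (@eq_Rintegral _ _ _ _ _
    (fun t => c j 0 * f j t + \sum_(i <- s) c i 0 * f i t)); last first.
    by move=> t _; rewrite big_cons.
  by rewrite RintegralD // RintegralZl // ih2 big_cons.
have [gi gI] := gsum D mD (@subset_refl _ D).
have gp : \int[mu]_(t in D) g t = (p *m c) 0 0.
  by rewrite gI mxE; apply: eq_bigr => j _; rewrite mxE mulrC.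
have p0 : (p *m c) 0 0 <= 0.
  rewrite -oppr_ge0.
  have -> : - (p *m c) 0 0 = ((- p) *m c) 0 0 by rewrite mulNmx [RHS]mxE.
  by apply: cP; exists 0, 1; rewrite scale1r sub0r.
have gint0 : \int[mu]_(t in D) g t = 0.
  by apply/eqP; rewrite eq_le {1}gp p0 Rintegral_ge0.
have mg : measurable_fun D g by apply/measurable_EFinP; exact: measurable_int gi.
pose D' := D `&` [set t | g t = 0].
have mD' : measurable D'.
  have -> : D' = D `&` g @^-1` [set 0] by [].
  exact: mg.
have D'D : D' `<=` D by move=> t [].
have muN : mu (D `\` D') = 0%E.
  have gE0 : (\int[mu]_(t in D) (EFin \o g) t = 0)%E.
    by rewrite -[LHS]fineK; [congr (_%:E)|exact: integrable_fin_num].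
  have : ae_eq mu D (EFin \o g) (cst 0%E).
    apply/ae_eq_integral_abs => //; first exact/measurable_EFinP.
    rewrite -[RHS]gE0; apply: eq_integral => t; rewrite inE => Dt.
    by rewrite /= ger0_norm // g0.
  move=> [N [mN N0 gN]]; apply: (subset_measure0 (B := N)) => //.
    exact: measurableD.
  by move=> t [Dt D't]; apply: gN => /= h; apply: D't; split => //; have [] := h Dt.
have fD' j : \int[mu]_(t in D) f j t = \int[mu]_(t in D') f j t.
  rewrite /Rintegral (negligible_integral _ mD (fi j) muN).
    by rewrite setDD (setIidr D'D).
  exact: measurableD.
have [i0 ci0] : exists i, c i 0 != 0.
  apply: contrapT => h; move/eqP: c0; apply; apply/colP => i; rewrite mxE.
  by apply/eqP/negPn/negP => ci; apply: h; exists i.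
have [j|m [lam [x [lam0 Dx xE]]]] := ih D' (fun j => f (lift i0 j)) mD'.
  exact: (integrableS mD mD' D'D).
exists m, lam, x; split => // [k|j]; first exact: D'D.
rewrite fD'; have [j' ->|->] := unliftP i0 j; first exact: xE.
have [_ gI'] := gsum D' mD' D'D.
have g'0 : \int[mu]_(t in D') g t = 0.
  rewrite (@eq_Rintegral _ _ _ _ _ (cst 0)); last by move=> t; rewrite inE => -[].
  by rewrite /Rintegral integral0.
have s0 : \sum_j c j 0 * \sum_k lam k * f j (x k) = 0.
  rewrite (eq_bigr (fun j => \sum_k lam k * (c j 0 * f j (x k)))).
    rewrite exchange_big /= big1 // => k _; rewrite -mulr_sumr.
    by have [_ gx] := Dx k; rewrite -/(g (x k)) gx mulr0.
  by move=> i _; rewrite mulr_sumr; apply: eq_bigr => k _; rewrite mulrCA.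
apply: (mulfI ci0).
move: gI' s0; rewrite g'0 (bigD1 i0) //= => /eqP; rewrite eq_sym addr_eq0 => /eqP ->.
rewrite (bigD1 i0) //= => /eqP; rewrite addr_eq0 => /eqP ->.
congr (- _); apply: eq_bigr => i ii0.
have [i' ->|ii] := unliftP i0 i; first by rewrite xE.
by rewrite ii eqxx in ii0.
Qed.

End Cones.

(** * Block matrices and complete positivity *)

Section Blocks.
Variables (R : realType) (n K : nat).
Local Notation C := R[i].

Lemma adj_mxcol m (A : 'I_K -> 'M[C]_(n, m)) :
  (\mxcol_i A i)^t* = \mxrow_i (A i)^t*.
Proof. by apply/matrixP => i j; rewrite !mxE. Qed.

(** Positivity of a block matrix, tested on stacked vectors. *)
Lemma psdmx_blockP (A : 'I_K -> 'I_K -> 'M[C]_n) :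
  psdmx (\mxblock_(i < K, j < K) A i j) <->
  forall v : 'I_K -> 'cV[C]_n,
    0 <= \sum_i \sum_j ((v i)^t* *m A i j *m v j) 0 0.
Proof.
have formE (v : 'I_K -> 'cV[C]_n) :
    ((\mxcol_i v i)^t* *m \mxblock_(i, j) A i j *m \mxcol_i v i) 0 0 =
    \sum_i \sum_j ((v i)^t* *m A i j *m v j) 0 0.
  rewrite adj_mxcol -mulmxA mul_mxblock_mxrow mul_mxrow_mxcol summxE.
  apply: eq_bigr => i _; rewrite mulmx_sumr summxE.
  by apply: eq_bigr => j _; rewrite mulmxA.
split=> A0 v; first by rewrite -formE; exact: A0.
by rewrite -[v](@submxcolK _ _ (fun=> n)) formE; exact: A0.
Qed.

(** Named, so that sums of matrices are not confused with this sum of sizes. *)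
Definition block_size : nat := (\sum_(i < K) n)%N.

(** Isometric inclusion of the k-th summand of the orthogonal direct sum. *)
Definition block_inj (k : 'I_K) : 'M[C]_(block_size, n) :=
  \mxcol_(i < K) ((if i == k then 1%:M else 0) : 'M[C]_n).

Lemma block_injK k l :
  (block_inj k)^t* *m block_inj l = if k == l then 1%:M else 0.
Proof.
rewrite /block_inj adj_mxcol mul_mxrow_mxcol (bigD1 k) //= eqxx big1 => [|i ik].
  by rewrite addr0 adjmx1 mul1mx.
by rewrite (negbTE ik) trmx0 map_mx0 mul0mx.
Qed.

Lemma mxcol_block_inj m (A : 'I_K -> 'M[C]_(n, m)) :
  \mxcol_i A i = \sum_k block_inj k *m A k :> 'M[C]_(block_size, m).
Proof.
pose D (k i : 'I_K) : 'M[C]_n := if i == k then 1%:M else 0.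
transitivity (\mxcol_(i < K) \sum_k D k i *m A k).
  apply: eq_mxcol => i; rewrite (bigD1 i) //= /D eqxx mul1mx.
  by rewrite big1 ?addr0 // => k ki; rewrite eq_sym (negbTE ki) mul0mx.
apply: etrans (mxcol_sum _ _) _; apply: eq_bigr => k _.
by rewrite /block_inj mxcol_mul.
Qed.

Lemma mulmx_block_inj m (v : 'M[C]_(m, block_size)) k :
  v *m block_inj k = submxrow (v : 'M[C]_(m, \sum_(i < K) n)) k.
Proof.
rewrite -[v in LHS]submxrowK mul_mxrow_mxcol (bigD1 k) //= eqxx mulmx1.
by rewrite big1 ?addr0 // => i ik; rewrite (negbTE ik) mulmx0.
Qed.

Lemma block_inj_eq0 m (v : 'M[C]_(m, block_size)) :
  (forall k, v *m block_inj k = 0) -> v = 0.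
Proof.
move=> v0; rewrite -[v]submxrowK -[0]submxrowK; apply: eq_mxrow => k.
by rewrite -!mulmx_block_inj v0 mul0mx.
Qed.

Definition block_diag (b : 'I_K -> 'M[C]_n) : 'M[C]_block_size :=
  \sum_k block_inj k *m b k *m (block_inj k)^t*.

Lemma block_diag_inj b k : block_diag b *m block_inj k = block_inj k *m b k.
Proof.
rewrite /block_diag mulmx_suml (bigD1 k) //= -mulmxA block_injK eqxx mulmx1.
rewrite big1 ?addr0 // => l lk.
by rewrite -mulmxA block_injK (negbTE lk) mulmx0.
Qed.

Lemma block_diag_herm b : (forall k, b k \is hermsymmx) ->
  block_diag b \is hermsymmx.
Proof.
move=> hb; apply/hermsymmxP; rewrite /block_diag adjmx_sum.
apply: eq_bigr => k _; rewrite !adjmxM trmxCK mulmxA.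
by rewrite (hermsymmxP _ (hb k)).
Qed.

Lemma block_diag_spectrum b (S : set R) :
  (forall k, spectrum_in (b k) S) -> spectrum_in (block_diag b) S.
Proof.
move=> bS z /eigenvalueP[v vB v0].
have [k vk] : exists k, v *m block_inj k != 0.
  apply: contrapT => h; move/eqP: v0; apply; apply: block_inj_eq0 => k.
  by apply/eqP/negPn/negP => vk; apply: h; exists k.
apply: (bS k); apply/eigenvalueP; exists (v *m block_inj k) => //.
by rewrite -mulmxA -block_diag_inj mulmxA vB scalemxAl.
Qed.

End Blocks.

(** * Jensen's operator inequality for finite families *)

Section FiniteJensen.
Variable R : realType.
Local Notation C := R[i].
Variables (J : set R) (theta : R -> R).
Hypothesis convex_theta : operator_convex J theta.

(** Hansen and Pedersen's argument.  With [P] the projection onto the range of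
    the isometry [V] and [S = 2P - 1], the average of [B] and [S B S] is block
    diagonal for [P], so that [V] intertwines it with the compression of [B],
    while [S] disappears against [V]. *)
Lemma jensen_isometry m n (B : 'M[C]_m) (V : 'M[C]_(m, n)) :
  B \is hermsymmx -> spectrum_in B J -> V^t* *m V = 1%:M ->
  loewner (fcalc theta (V^t* *m B *m V)) (V^t* *m fcalc theta B *m V).
Proof.
move=> hB sB V1; pose P := V *m V^t*; pose S := P + P - 1%:M.
have hP : P^t* = P by rewrite /P adjmxM trmxCK.
have hS : S^t* = S by rewrite /S adjmxB adjmxD hP adjmx1.
have PV : P *m V = V by rewrite /P -mulmxA V1 mulmx1.
have SV : S *m V = V by rewrite /S mulmxBl mulmxDl PV mul1mx addrK.
have PP : P *m P = P by rewrite {2}/P mulmxA PV.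
have SS : S *m S = 1%:M.
  rewrite {2}/S mulmxBr mulmxDr mulmx1.
  have -> : S *m P = P by rewrite /S mulmxBl mulmxDl PP mul1mx addrK.
  by rewrite /S opprB addrC subrK.
have VS : V^t* *m S = V^t* by rewrite -[S]hS -adjmxM SV.
pose B' := S *m B *m S.
have hB' : B' \is hermsymmx.
  apply/hermsymmxP; rewrite /B' !adjmxM hS (hermsymmxP _ hB).
  by rewrite mulmxA.
have B'S : B' *m S = S *m B by rewrite /B' -mulmxA SS mulmx1.
have sB' : spectrum_in B' J.
  move=> z /eigenvalueP[v vB' v0]; apply: sB; apply/eigenvalueP.
  exists (v *m S); first by rewrite -mulmxA -B'S mulmxA vB' scalemxAl.
  by apply: contra v0 => /eqP vS; rewrite -[v]mulmx1 -SS mulmxA vS mul0mx.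
have fB' : fcalc theta B' = S *m fcalc theta B *m S.
  by rewrite -(fcalc_intertwine theta hB' hB B'S) -mulmxA SS mulmx1.
pose t : R := 2^-1.
have t1 : 1 - t = t by rewrite /t [X in X - _](splitr 1) mul1r addrK.
pose A := (1 - t)%:C *: B + t%:C *: B'.
have t01 : 0 <= t <= 1 by rewrite invr_ge0 ler0n invf_le1 ?ler1n.
have hA : A \is hermsymmx.
  apply/hermsymmxP; rewrite /A adjmxD !adjmxZ (hermsymmxP _ hB).
  by rewrite (hermsymmxP _ hB') !conj_Creal // complex_real.
have W : V^t* *m B *m V \is hermsymmx.
  by apply/hermsymmxP; rewrite !adjmxM trmxCK (hermsymmxP _ hB) mulmxA.
have AV : A *m V = V *m (V^t* *m B *m V).
  rewrite /A t1 mulmxDl -!scalemxAl -scalerDr /B' -[S *m B *m S *m V]mulmxA SV.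
  have -> : B *m V + S *m B *m V = (2 : C) *: (P *m B *m V).
    rewrite /S mulmxBl mulmxDl mul1mx mulNmx !mulmxDl addrC subrK.
    by rewrite scaler_nat mulr2n.
  rewrite scalerA -(rmorph_nat (real_complex R)) -rmorphM /= mulVf ?pnatr_eq0 //.
  by rewrite scale1r /P !mulmxA.
have fA := fcalc_intertwine theta hA W AV.
have := psdmx_congr V (convex_theta t01 hB hB' sB sB').
rewrite -/A /loewner fB'; congr psdmx.
(* only the intertwining relation matters from here on *)
move: (fcalc theta B) (fcalc theta A) (fcalc theta (V^t* *m B *m V)) fA.
move=> fB fA fW fAV.
rewrite mulmxBr mulmxBl -[V^t* *m fA *m V]mulmxA fAV mulmxA V1 mul1mx.
congr (_ - _); rewrite t1 -scalerDr -scalemxAr -scalemxAl mulmxDr mulmxDl.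
rewrite !mulmxA VS -[_ *m S *m V]mulmxA SV -mulr2n -scaler_nat scalerA.
rewrite -(rmorph_nat (real_complex R)) -rmorphM /= mulVf ?pnatr_eq0 //.
by rewrite scale1r.
Qed.

(** The isometry is the column of the [a k]; it compresses the block diagonal
    matrix with blocks [b k]. *)
Lemma jensen_finite n K (a b : 'I_K -> 'M[C]_n) :
  (forall k, b k \is hermsymmx) -> (forall k, spectrum_in (b k) J) ->
  \sum_k (a k)^t* *m a k = 1%:M ->
  loewner (fcalc theta (\sum_k (a k)^t* *m b k *m a k))
          (\sum_k (a k)^t* *m fcalc theta (b k) *m a k).
Proof.
move=> hb sb a1; pose V := \mxcol_k a k; pose B := block_diag b.
have hB : B \is hermsymmx by exact: block_diag_herm.
have V1 : V^t* *m V = 1%:M by rewrite /V adj_mxcol mul_mxrow_mxcol.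
have VJ k : V^t* *m block_inj R n k = (a k)^t*.
  by rewrite mulmx_block_inj /V adj_mxcol mxrowK.
have BV : V^t* *m B *m V = \sum_k (a k)^t* *m b k *m a k.
  rewrite {2}/V mxcol_block_inj mulmx_sumr; apply: eq_bigr => k _.
  by rewrite !mulmxA -[V^t* *m B *m _]mulmxA block_diag_inj mulmxA VJ.
have fBV : V^t* *m fcalc theta B *m V =
    \sum_k (a k)^t* *m fcalc theta (b k) *m a k.
  have := fun k => fcalc_intertwine theta hB (hb k) (block_diag_inj b k).
  move: (fcalc theta B) => fB fBJ.
  rewrite {2}/V mxcol_block_inj mulmx_sumr; apply: eq_bigr => k _.
  move: (fcalc theta (b k)) (fBJ k) => fb fBk.
  by rewrite mulmxA -[V^t* *m fB *m _]mulmxA fBk mulmxA VJ.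
by rewrite -BV -fBV; apply: jensen_isometry => //; exact: block_diag_spectrum.
Qed.

End FiniteJensen.

(** * Channels with selfadjoint Kraus operators *)

Section CompletelyPositive.
Variables (R : realType) (n : nat).
Local Notation C := R[i].

Lemma completely_positive_comp (f g : 'M[C]_n -> 'M[C]_n) :
  completely_positive f -> completely_positive g ->
  completely_positive (f \o g).
Proof. by move=> fcp gcp k A A0; apply: fcp; exact: gcp. Qed.

Lemma completely_positive_sum (I : Type) (r : seq I)
    (f : I -> 'M[C]_n -> 'M[C]_n) : (forall i, completely_positive (f i)) ->
  completely_positive (fun z => \sum_(i <- r) f i z).
Proof.
move=> fcp k A A0; apply/psdmx_blockP => v; elim: r => [|i r ih].
  rewrite big1 // => i _; rewrite big1 // => j _.
  by rewrite big_nil mulmx0 mul0mx mxE.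
have /psdmx_blockP/(_ v) fi := fcp i k A A0.
rewrite (_ : \sum_(_ < k) _ =
  \sum_p \sum_q ((v p)^t* *m f i (A p q) *m v q) 0 0 +
  \sum_p \sum_q ((v p)^t* *m (\sum_(j <- r) f j (A p q)) *m v q) 0 0).
  exact: (addr_ge0 fi ih).
rewrite -big_split; apply: eq_bigr => p _.
rewrite -big_split; apply: eq_bigr => q _ /=.
by rewrite big_cons mulmxDr mulmxDl mxE.
Qed.

Lemma completely_positiveZ (c : C) (f : 'M[C]_n -> 'M[C]_n) : 0 <= c ->
  completely_positive f -> completely_positive (fun z => c *: f z).
Proof.
move=> c0 fcp k A A0; apply/psdmx_blockP => v.
have /psdmx_blockP/(_ v) fA := fcp k A A0.
rewrite (_ : \sum_(_ < k) _ =
  c * \sum_p \sum_q ((v p)^t* *m f (A p q) *m v q) 0 0); first exact: mulr_ge0.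
rewrite mulr_sumr; apply: eq_bigr => p _.
rewrite mulr_sumr; apply: eq_bigr => q _.
by rewrite -scalemxAr -scalemxAl mxE.
Qed.

Lemma completely_positive_congr (a : 'M[C]_n) :
  completely_positive (fun z => a^t* *m z *m a).
Proof.
move=> k A /psdmx_blockP A0; apply/psdmx_blockP => v.
have := A0 (fun i => a *m v i); congr (0 <= _).
apply: eq_bigr => p _; apply: eq_bigr => q _.
by rewrite adjmxM !mulmxA.
Qed.

Lemma completely_positive_id : completely_positive (@id 'M[C]_n).
Proof. by []. Qed.

Lemma completely_positive_iter (f : 'M[C]_n -> 'M[C]_n) j :
  completely_positive f -> completely_positive (iter j f).
Proof.
move=> fcp; elim: j => [|j ih]; first exact: completely_positive_id.
exact: (completely_positive_comp fcp ih).
Qed.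

(** Cesaro means are nonnegative combinations of iterates. *)
Lemma completely_positive_cesaro (f : 'M[C]_n -> 'M[C]_n) N :
  completely_positive f -> completely_positive (cesaro_mean f N).
Proof.
move=> fcp; case: N => [|N].
  rewrite (_ : cesaro_mean f 0 = fun z => 0 *: z).
    exact: completely_positiveZ (lexx 0) completely_positive_id.
  by apply/funext => z; rewrite /cesaro_mean invr0 !scale0r.
rewrite (_ : cesaro_mean f N.+1 = fun z =>
    N.+1%:R^-1 *: \sum_(0 <= j < N.+1) iter j f z).
  apply: completely_positiveZ; first by rewrite invr_ge0.
  by apply: completely_positive_sum => j; exact: completely_positive_iter.
by apply/funext => z; rewrite /cesaro_mean [in RHS]big_ltn.
Qed.

(** Complete positivity passes to entrywise limits, being a family of
    inequalities between linear combinations of entries. *)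
Lemma completely_positive_lim (f : nat -> 'M[C]_n -> 'M[C]_n)
    (g : 'M[C]_n -> 'M[C]_n) :
  (forall N, completely_positive (f N)) ->
  (forall z i j, f N z i j @[N --> \oo] --> g z i j) ->
  completely_positive g.
Proof.
move=> fcp fg k A A0; apply/psdmx_blockP => v.
pose form (h : 'M[C]_n -> 'M[C]_n) : C :=
  \sum_p \sum_q ((v p)^t* *m h (A p q) *m v q) 0 0.
have f0 N : 0 <= form (f N).
  by have /psdmx_blockP/(_ v) := fcp N k A A0.
have fgv : form (f N) @[N --> \oo] --> form g.
  apply: cvg_finsum => p; apply: cvg_finsum => q.
  have formE (M : 'M[C]_n) : ((v p)^t* *m M *m v q) 0 0 =
      \sum_j \sum_i ((v p)^t* 0 i * v q j 0) * M i j.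
    rewrite mxE; apply: eq_bigr => j _; rewrite mxE mulr_suml.
    by apply: eq_bigr => i _; rewrite mulrAC.
  under eq_fun do rewrite formE; rewrite formE.
  by apply: cvg_finsum => j; apply: cvg_finsum => i; exact: cvgMl_tmp.
rewrite -/(form g) lecE; apply/andP; split.
  have := cvg_comp _ _ fgv (@continuous_Im R (form g)).
  rewrite (_ : _ \o _ = cst 0); last first.
    by apply/funext => N /=; exact: ger0_Im.
  by move=> h; apply/eqP/esym; apply: (cvg_unique _ _ h) => //; exact: cvg_cst.
have := cvg_comp _ _ fgv (@continuous_Re R (form g)) => h.
apply: (cvgr_to_ge h); apply: nearW => N /=.
by have := f0 N; rewrite lecE => /andP[].
Qed.

End CompletelyPositive.

Lemma mean_natmul (F : numFieldType) (V : lmodType F) N (u v : V) :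
  N.+1%:R^-1 *: (u *+ N.+1 + v) = u + N.+1%:R^-1 *: v.
Proof.
by rewrite scalerDr -[u *+ _]scaler_nat scalerA mulVf ?scale1r // pnatr_eq0.
Qed.

(** A linear map is determined by its values on matrix units. *)
Lemma linear_delta_expand (F : fieldType) n (f : 'M[F]_n -> 'M[F]_n) : linear f ->
  forall z, f z = \sum_(p : 'I_n * 'I_n) z p.1 p.2 *: f (delta_mx p.1 p.2).
Proof.
move=> f_lin z; have f0 : f 0 = 0.
  by have := f_lin (-1) 0 0; rewrite scaler0 addr0 scaleN1r addNr.
rewrite [in LHS](matrix_sum_delta z) pair_bigA /=.
elim: (index_enum _) => [|p s ih]; first by rewrite !big_nil.
by rewrite !big_cons f_lin ih.
Qed.

Section Kraus.
Variables (C : numClosedFieldType) (n K : nat) (a : 'I_K -> 'M[C]_n).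
Hypotheses (a_adj : forall k, (a k)^t* = a k).
Hypothesis (a_unit : \sum_k a k *m a k = 1%:M).

(** Kraus form of a completely positive map whose Kraus operators are
    selfadjoint, hence without adjoint on either side. *)
Definition kraus (z : 'M[C]_n) : 'M[C]_n := \sum_k a k *m z *m a k.

Lemma kraus_is_linear : linear kraus.
Proof.
move=> c y z; rewrite /kraus scaler_sumr -big_split; apply: eq_bigr => k _ /=.
by rewrite mulmxDr mulmxDl -scalemxAr -scalemxAl.
Qed.

HB.instance Definition _ :=
  GRing.isLinear.Build C 'M[C]_n 'M[C]_n _ kraus kraus_is_linear.

Lemma kraus1 : kraus 1%:M = 1%:M.
Proof. by rewrite -[RHS]a_unit; apply: eq_bigr => k _; rewrite mulmx1. Qed.

Lemma kraus_adj z : (kraus z)^t* = kraus (z^t*).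
Proof.
rewrite /kraus adjmx_sum; apply: eq_bigr => k _.
by rewrite !adjmxM !a_adj mulmxA.
Qed.

Lemma kraus_tr_mul y z : \tr (y *m kraus z) = \tr (kraus y *m z).
Proof.
rewrite /kraus mulmx_sumr mulmx_suml !raddf_sum; apply: eq_bigr => k _ /=.
by rewrite mulmxA mxtrace_mulC !mulmxA.
Qed.

Lemma kraus_tr z : \tr (kraus z) = \tr z.
Proof. by rewrite -[kraus z]mul1mx kraus_tr_mul kraus1 mul1mx. Qed.

Lemma tr_unit_l y : \sum_k \tr (y *m a k *m a k) = \tr y.
Proof.
rewrite -raddf_sum /=; under eq_bigr do rewrite -mulmxA.
by rewrite -mulmx_sumr a_unit mulmx1.
Qed.

(** Write E for the channel.  The trace of E(z* z) - z* z vanishes while, for a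
    fixed point z, that matrix is the sum of the positive matrices c* c, with c
    ranging over the commutators of z with the Kraus operators. *)
Lemma kraus_fixedP z : kraus z = z <-> forall k, a k *m z = z *m a k.
Proof.
split=> [zfix|zcomm]; last first.
  rewrite /kraus; under eq_bigr do rewrite zcomm -mulmxA.
  by rewrite -mulmx_sumr a_unit mulmx1.
pose c k := a k *m z - z *m a k.
have c_tr k : \tr ((c k)^t* *m c k) =
    \tr (z^t* *m (a k *m a k) *m z) - \tr (z^t* *m (a k *m z *m a k))
    - \tr (z^t* *m (a k *m z *m a k)) + \tr (z^t* *m z *m a k *m a k).
  have e1 : \tr (a k *m z^t* *m (a k *m z)) = \tr (z^t* *m (a k *m z *m a k)).
    by rewrite -mulmxA mxtrace_mulC !mulmxA.
  have e2 : \tr (a k *m z^t* *m (z *m a k)) = \tr (z^t* *m z *m a k *m a k).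
    by rewrite -mulmxA mxtrace_mulC !mulmxA.
  rewrite /c adjmxB !adjmxM a_adj mulmxBr !mulmxBl opprB addrA.
  by rewrite !raddfD /= !raddfN /= e1 e2 !mulmxA addrAC.
have c0 k : \tr ((c k)^t* *m c k) = 0.
  have ge0 l : 0 <= \tr ((c l)^t* *m c l) := mxtr_gram_ge0 (c l).
  have /eqP : \sum_l \tr ((c l)^t* *m c l) = 0.
    under eq_bigr do rewrite c_tr.
    rewrite !big_split /= !sumrN tr_unit_l.
    have -> : \sum_l \tr (z^t* *m (a l *m a l) *m z) = \tr (z^t* *m z).
      rewrite -raddf_sum /= -mulmx_suml -mulmx_sumr a_unit.
      by rewrite mulmx1.
    have -> : \sum_l \tr (z^t* *m (a l *m z *m a l)) = \tr (z^t* *m z).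
      by rewrite -raddf_sum /= -mulmx_sumr -/(kraus z) zfix.
    by rewrite subrr sub0r addNr.
  by rewrite psumr_eq0 => [/allP/(_ k (mem_index_enum _))/eqP|l _].
by move=> k; apply/eqP; rewrite -subr_eq0; apply/eqP/mxtr_gram_eq0/c0.
Qed.

(** Kadison-Schwarz: E(z* z) - E(z)* E(z) is the sum of the positive matrices
    c* c for [c k = z *m a k - a k *m kraus z], and E preserves the trace. *)
Lemma kraus_contract z :
  \tr ((kraus z)^t* *m kraus z) <= \tr (z^t* *m z).
Proof.
pose y := kraus z; pose c k := z *m a k - a k *m y.
have c_tr k : \tr ((c k)^t* *m c k) =
    \tr (a k *m (z^t* *m z) *m a k) - \tr (a k *m z^t* *m a k *m y)
    - \tr (y^t* *m (a k *m z *m a k)) + \tr (y^t* *m (a k *m a k) *m y).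
  rewrite /c adjmxB !adjmxM a_adj mulmxBr !mulmxBl opprB addrA.
  rewrite !raddfD /= !raddfN /= !mulmxA addrAC; congr (_ + _).
  exact: addrAC.
have : 0 <= \sum_k \tr ((c k)^t* *m c k).
  by apply: sumr_ge0 => k _; exact: mxtr_gram_ge0.
under eq_bigr do rewrite c_tr.
rewrite !big_split /= !sumrN.
have -> : \sum_k \tr (a k *m (z^t* *m z) *m a k) = \tr (z^t* *m z).
  by rewrite -raddf_sum /= -/(kraus _) kraus_tr.
have -> : \sum_k \tr (a k *m z^t* *m a k *m y) = \tr (y^t* *m y).
  by rewrite -raddf_sum /= -mulmx_suml -/(kraus _) -kraus_adj.
have -> : \sum_k \tr (y^t* *m (a k *m z *m a k)) = \tr (y^t* *m y).
  by rewrite -raddf_sum /= -mulmx_sumr.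
have -> : \sum_k \tr (y^t* *m (a k *m a k) *m y) = \tr (y^t* *m y).
  by rewrite -raddf_sum /= -mulmx_suml -mulmx_sumr a_unit mulmx1.
by rewrite subrK subr_ge0.
Qed.

Lemma iter_kraus_contract j z :
  \tr ((iter j kraus z)^t* *m iter j kraus z) <= \tr (z^t* *m z).
Proof.
elim: j => [|j ih] /=; first exact: lexx.
exact: le_trans (kraus_contract _) ih.
Qed.

(** The estimate t <= 1 + t^2 makes a square root superfluous. *)
Lemma iter_kraus_bounded j z p q :
  `|iter j kraus z p q| <= 1 + \tr (z^t* *m z).
Proof.
set y := iter j kraus z; apply: (@le_trans _ _ (1 + `|y p q| ^+ 2)).
  rewrite -subr_ge0; have -> : 1 + `|y p q| ^+ 2 - `|y p q| =
      (`|y p q| - 1) ^+ 2 + `|y p q|.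
    by rewrite sqrrB1 [_ + 1]addrC -!addrA; congr (_ + (_ + _));
      rewrite mulr2n opprD -addrA addNr addr0.
  by rewrite addr_ge0 // -realEsqr realB.
rewrite lerD2l; apply: le_trans (iter_kraus_contract j z).
rewrite mxtr_gram (bigD1 q) //= (bigD1 p) //= -addrA lerDl addr_ge0 //.
  by apply: sumr_ge0 => i _; rewrite exprn_ge0.
by apply: sumr_ge0 => k _; apply: sumr_ge0 => i _; rewrite exprn_ge0.
Qed.

Lemma iter_kraus_telescope k w : kraus k = k -> forall N,
  \sum_(0 <= j < N) iter j kraus (k + (w - kraus w)) =
  k *+ N + (w - iter N kraus w).
Proof.
move=> kfix N.
have iterE j : iter j kraus (k + (w - kraus w)) =
    k + (iter j kraus w - iter j.+1 kraus w).
  elim: j => [//|j ih]; rewrite iterS ih linearD linearB /= kfix.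
  by [].
elim: N => [|N ih]; first by rewrite big_geq //= mulr0n subrr addr0.
rewrite big_nat_recr //= ih iterE mulrSr -!addrA; congr (_ + _).
by rewrite [- _ + _]addrCA addKr addrCA.
Qed.

Let M := lin_mx kraus.
Let fixM := kermx (1%:M - M).
Let ranM := 1%:M - M.

Let kraus_vec (u : 'rV[C]_(n * n)) : u *m M = mxvec (kraus (vec_mx u)).
Proof. exact: mul_rV_lin. Qed.

(** By selfadjointness of the channel for the trace inner product, the kernel
    and the range of [1 - E] are orthogonal. *)
Let fix_ran_cap : (fixM :&: ranM = 0)%MS.
Proof.
apply/eqP; rewrite -submx0; apply/rV_subP => u.
rewrite sub_capmx => /andP[/sub_kermxP uM /submxP[w uE]].
pose x := vec_mx u; pose y := vec_mx w.
have xfix : kraus x = x.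
  apply: (can_inj mxvecK); rewrite -kraus_vec vec_mxK.
  by move/eqP: uM; rewrite mulmxBr mulmx1 subr_eq0 => /eqP.
have xE : x = y - kraus y.
  apply: (can_inj mxvecK); rewrite vec_mxK linearB /= -kraus_vec vec_mxK uE.
  by rewrite /ranM mulmxBr mulmx1.
have x0 : x = 0.
  apply: mxtr_gram_eq0; rewrite {2}xE mulmxBr raddfB /= kraus_tr_mul.
  by rewrite -kraus_adj xfix subrr.
by rewrite -[u]vec_mxK -/x x0 linear0 sub0mx.
Qed.

(** Rank-nullity: the two subspaces, being disjoint, span everything. *)
Let fix_ran_add : (1%:M <= fixM + ranM)%MS.
Proof.
rewrite sub1mx /row_full mxrank_disjoint_sum ?fix_ran_cap //.
by rewrite mxrank_ker subnK // rank_leq_row.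
Qed.

(** Projection onto the kernel of [1 - E] along its range, in coordinates. *)
Definition ergodic_projection (z : 'M[C]_n) : 'M[C]_n :=
  vec_mx (mxvec z *m proj_mx fixM ranM).

Lemma ergodic_projection_fixed z :
  kraus (ergodic_projection z) = ergodic_projection z.
Proof.
apply: (can_inj mxvecK); rewrite -kraus_vec vec_mxK.
have /sub_kermxP/eqP := proj_mx_sub fixM ranM (mxvec z).
by rewrite mulmxBr mulmx1 subr_eq0 => /eqP <-.
Qed.

Lemma ergodic_projection_id z : kraus z = z -> ergodic_projection z = z.
Proof.
move=> zfix; rewrite /ergodic_projection proj_mx_id ?mxvecK ?fix_ran_cap //.
apply/sub_kermxP; rewrite mulmxBr mulmx1 kraus_vec mxvecK zfix.
by rewrite subrr.
Qed.

Lemma ergodic_projection_compl z :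
  exists w, z = ergodic_projection z + (w - kraus w).
Proof.
have zin : (mxvec z <= fixM + ranM)%MS := submx_trans (submx1 _) fix_ran_add.
have /submxP[w wE] := proj_mx_compl_sub zin.
exists (vec_mx w); apply: (can_inj mxvecK).
rewrite !linearD linearN /= -kraus_vec !vec_mxK.
have -> : w - w *m M = w *m ranM by rewrite /ranM mulmxBr mulmx1.
by rewrite -wE addrC subrK.
Qed.

Lemma ergodic_projection_linear : linear ergodic_projection.
Proof.
move=> c y z; rewrite /ergodic_projection linearP /= mulmxDl -scalemxAl.
by rewrite linearP.
Qed.

Lemma ergodic_projection_trace z : \tr (ergodic_projection z) = \tr z.
Proof.
 have [w {2}->] := ergodic_projection_compl z.
by rewrite raddfD raddfB /= kraus_tr subrr addr0.
Qed.

Lemma ergodic_projection_range :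
  range ergodic_projection = [set z | kraus z = z].
Proof.
apply/seteqP; split => [_ [z _ <-]|z /= zfix].
  exact: ergodic_projection_fixed.
by exists z => //; exact: ergodic_projection_id.
Qed.

End Kraus.

Section KrausErgodic.
Variables (R : realType) (n K : nat) (a : 'I_K -> 'M[R[i]]_n).
Local Notation C := R[i].
Hypotheses (a_adj : forall k, (a k)^t* = a k).
Hypothesis (a_unit : \sum_k a k *m a k = 1%:M).
Local Notation kraus := (kraus a).
Local Notation ergodic_projection := (ergodic_projection a).

Lemma kraus_cp : completely_positive kraus.
Proof.
apply: completely_positive_sum => k; rewrite -{1}[a k]a_adj.
exact: completely_positive_congr.
Qed.

Lemma cesaro_meanE N z :
  cesaro_mean kraus N.+1 z = N.+1%:R^-1 *: \sum_(0 <= j < N.+1) iter j kraus z.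
Proof. by rewrite /cesaro_mean [in RHS]big_ltn. Qed.

Lemma cvg_inv_bounded (u : nat -> C) (c : C) : (forall N, `|u N| <= c) ->
  N.+1%:R^-1 * u N @[N --> \oo] --> (0 : C).
Proof.
move=> uc; have c0 : 0 <= c by apply: le_trans (uc 0%N).
have cE : c = (complex.Re c)%:C by rewrite RRe_real // ger0_real.
apply/(@cvgrPdist_lt C C) => e e0.
have eE : e = (complex.Re e)%:C by rewrite RRe_real // gtr0_real.
have re0 : 0 < complex.Re e by move: e0; rewrite {1}eE ltcR.
near=> N; rewrite sub0r normrN normrM.
have N0 : 0 < N.+1%:R :> C by rewrite ltr0n.
rewrite ger0_norm ?invr_ge0 // ltr_pdivrMl //.
apply: le_lt_trans (uc N) _; rewrite cE eE -(rmorph_nat (real_complex R)).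
rewrite -rmorphM ltcR -ltr_pdivrMr //.
have Nlt : complex.Re c / complex.Re e < N%:R.
  by near: N; exact: nbhs_infty_gtr.
by rewrite (lt_le_trans Nlt) // ler_nat.
Unshelve. all: by end_near. Qed.

(** The iterates of the coboundary [w - kraus w] telescope to a bounded sum. *)
Lemma cesaro_kraus_cvg k w p q : kraus k = k ->
  cesaro_mean kraus N (k + (w - kraus w)) p q @[N --> \oo] --> k p q.
Proof.
move=> kfix; rewrite -(cvg_shiftS (fun N => cesaro_mean kraus N _ p q)).
have -> : (fun N => cesaro_mean kraus N.+1 (k + (w - kraus w)) p q) =
    (fun N => k p q + N.+1%:R^-1 * (w p q - iter N.+1 kraus w p q)).
  apply/funext => N; rewrite cesaro_meanE iter_kraus_telescope // mean_natmul.
  by rewrite !mxE.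
pose c := 1 + \tr (w^t* *m w).
have rest : N.+1%:R^-1 * (w p q - iter N.+1 kraus w p q) @[N --> \oo] --> (0 : C).
  apply: (@cvg_inv_bounded _ (c + c)) => N; apply: le_trans (ler_normB _ _) _.
  apply: lerD; first exact: (iter_kraus_bounded a_adj a_unit 0).
  exact: (iter_kraus_bounded a_adj a_unit N.+1).
by have := cvgD (cvg_cst (k p q)) rest; rewrite addr0; apply.
Qed.

Lemma ergodic_projection_cvg z p q :
  cesaro_mean kraus N z p q @[N --> \oo] --> ergodic_projection z p q.
Proof.
have [w {1}->] := ergodic_projection_compl a_adj z.
exact/cesaro_kraus_cvg/ergodic_projection_fixed.
Qed.

Lemma ergodic_projection_expectation :
  conditional_expectation ergodic_projection.
Proof.
split.
- exact: ergodic_projection_linear.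
- exact/(ergodic_projection_id a_adj)/kraus1.
- apply: (completely_positive_lim _ ergodic_projection_cvg) => N.
  exact/completely_positive_cesaro/kraus_cp.
- apply/funext => z /=.
  exact/(ergodic_projection_id a_adj)/ergodic_projection_fixed.
Qed.

End KrausErgodic.

(** * Topology of matrices *)

Section MatrixTopology.
Variable R : realType.
Local Notation C := R[i].

Lemma cvg_mx m n (F : nat -> 'M[C]_(m, n)) (L : 'M[C]_(m, n)) :
  (forall i j, F N i j @[N --> \oo] --> L i j) -> F N @[N --> \oo] --> L.
Proof.
move=> FL; apply/cvg_ballP => e e0.
have : \forall N \near \oo, forall ij : 'I_m * 'I_n,
    ball (L ij.1 ij.2) e (F N ij.1 ij.2).
  apply: filter_forall => -[i j] /=.
  by have /cvg_ballP/(_ e e0) := FL i j.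
apply: filterS => N FN; split => // i j; exact: (FN (i, j)).
Qed.

Lemma cvg_lin_mx m n p q (F : nat -> 'M[C]_(m, n) -> 'M[C]_(p, q))
    (L : 'M[C]_(m, n) -> 'M[C]_(p, q)) :
  (forall z i j, F N z i j @[N --> \oo] --> L z i j) ->
  lin_mx (F N) @[N --> \oo] --> lin_mx L.
Proof.
move=> FL; apply: cvg_mx => i j; case/mxvec_indexP: j => j k.
have lin_mxE (f : 'M[C]_(m, n) -> 'M[C]_(p, q)) :
    lin_mx f i (mxvec_index j k) = f (vec_mx (delta_mx 0 i)) j k.
  by rewrite mxE /= mxvecE.
by under eq_fun do rewrite lin_mxE; rewrite lin_mxE; exact: FL.
Qed.

End MatrixTopology.

(** * Quantum expectations as finite sums *)

Section QuantumExpectation.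
Variables (R : realType) (d : nat) (X : ptopologicalType).
Local Notation C := R[i].
Local Notation Re := complex.Re.
Local Notation Im := complex.Im.
Variables (nu : povm R d X) (h : X -> 'M[C]_d).
Hypothesis RNh : is_RN_derivative nu h.
Local Notation mu := (trace_measure nu).

Lemma povm_dim_gt0 : (0 < d)%N.
Proof.
case: posnP => // d0; exfalso; apply: (@povm_neq0 _ _ _ nu).
by apply/matrixP => i; have := ltn_ord i; rewrite {2}d0.
Qed.

Lemma mxtrace_delta (A : 'M[C]_d) i j : \tr (delta_mx j i *m A) = A i j.
Proof.
rewrite /mxtrace (bigD1 j) //= big1 ?addr0 => [|k kj]; last first.
  by rewrite mxE big1 // => l _; rewrite mxE (negbTE kj) mul0r.
rewrite mxE (bigD1 i) //= big1 ?addr0 => [|k ki]; last first.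
  by rewrite mxE (negbTE ki) andbF mul0r.
by rewrite mxE !eqxx mul1r.
Qed.

Lemma quantum_random_variableP (psi : X -> 'M[C]_d) :
  quantum_random_variable psi <-> mmeasurable (psi : borel X -> _).
Proof.
split=> [mpsi i j|mpsi rho _]; last first.
  apply/Borel_funP.
  exact: (mmeasurable_tr (mmeasurableM (mmeasurable_cst _ rho) mpsi)).
pose P A := @cmeasurable _ (borel X) R (fun x => \tr (A *m psi x)).
suff : forall A, P A.
  by move=> /(_ (delta_mx j i)); rewrite /P; under eq_fun do rewrite mxtrace_delta.
apply: (state_span povm_dim_gt0) => [A /mpsi /Borel_funP //|c A B PA PB].
rewrite /P; under eq_fun do rewrite mulmxDl -scalemxAl linearD linearZ /=.
by apply: cmeasurableD => //; apply: cmeasurableM => //; exact: cmeasurable_cst.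
Qed.

Lemma derivative_psd x : psdmx (h x).
Proof. by have [] := RNh. Qed.

(** Square root of the Radon-Nikodym derivative. *)
Definition rn_root (x : X) : 'M[C]_d := sqrtmx (h x).

Lemma rn_root_adj x : (rn_root x)^t* = rn_root x.
Proof. exact: sqrtmx_adj. Qed.

Lemma rn_root_sqr x : rn_root x *m rn_root x = h x.
Proof. exact/sqrtmxK/derivative_psd. Qed.

Lemma mmeasurable_rn_root : mmeasurable (rn_root : borel X -> _).
Proof.
have [_ /quantum_random_variableP mh _ _] := RNh.
apply: (@fcalc_measurable_Borel _ (borel X) R d Num.sqrt _ h) => //.
  by apply: continuous_measurable_fun; exact: sqrt_continuous.
by move=> x; exact/psdmx_hermsym/derivative_psd.
Qed.

(** The operator-valued integrand of the quantum expectation, whose pairings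
    with states are the compressed functions. *)
Definition sandwich (psi : X -> 'M[C]_d) (x : X) : 'M[C]_d :=
  rn_root x *m psi x *m rn_root x.

Lemma mmeasurable_sandwich (psi : X -> 'M[C]_d) :
  mmeasurable (psi : borel X -> _) ->
  mmeasurable (sandwich psi : borel X -> _).
Proof.
move=> mpsi; apply: mmeasurableM; last exact: mmeasurable_rn_root.
by apply: mmeasurableM => //; exact: mmeasurable_rn_root.
Qed.

Lemma compressedE psi rho :
  compressed h psi rho = (fun x => \tr (rho *m sandwich psi x)).
Proof. by apply/funext => x; rewrite /compressed /sandwich !mulmxA. Qed.

Let mT : Borel_set [set: X] := @measurableT _ (borel X).

(** Integrability against states extends to all functionals, hence to entries,
    because states span. *)
Lemma nu_integrableP (psi : X -> 'M[C]_d) : nu_integrable nu h psi <->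
  mmeasurable (psi : borel X -> _) /\
  forall i j, cintegrable mu setT (fun x => sandwich psi x i j).
Proof.
split=> [[/quantum_random_variableP mpsi ipsi]|[mpsi ipsi]].
  split=> // i j; pose P A := cintegrable mu setT (fun x => \tr (A *m sandwich psi x)).
  suff : forall A, P A.
    by move=> /(_ (delta_mx j i)); rewrite /P; under eq_fun do rewrite mxtrace_delta.
  apply: (state_span povm_dim_gt0) => [A /ipsi|c A B PA PB].
    by rewrite compressedE.
  rewrite /P; under eq_fun do rewrite mulmxDl -scalemxAl linearD linearZ /=.
  exact: (proj1 (cintegrable_lin mT c PA PB)).
split=> [|rho _]; first exact/quantum_random_variableP.
rewrite compressedE.
exact: (proj1 (mintegral_tr mT rho ipsi)).
Qed.

Lemma quantum_expectationE (psi : X -> 'M[C]_d) : nu_integrable nu h psi ->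
  quantum_expectation nu h psi = mintegral mu setT (sandwich psi).
Proof.
move=> /nu_integrableP[mpsi ipsi]; apply: xget_unique => [rho _ /=|A /= AP].
  rewrite compressedE.
  by rewrite (proj2 (mintegral_tr mT rho ipsi)).
have AE B : \tr (B *m A) = \tr (B *m mintegral mu setT (sandwich psi)).
  move: B; apply: (state_span povm_dim_gt0) => [rho /AP ->|c A1 A2 e1 e2].
    rewrite compressedE.
    by rewrite (proj2 (mintegral_tr mT rho ipsi)).
  by rewrite !mulmxDl !linearD -!scalemxAl !linearZ /= e1 e2.
by apply/matrixP => i j; rewrite -!mxtrace_delta AE.
Qed.

(** The squared Hilbert-Schmidt norm of the root is the trace of the derivative. *)
Lemma rn_root_entry_le x i k l j :
  `|rn_root x i k| * `|rn_root x l j| <= 2 * \tr (h x).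
Proof.
have sq p q : `|rn_root x p q| ^+ 2 <= \tr (h x).
  rewrite -rn_root_sqr -{2}rn_root_adj mxtr_gram (bigD1 q) //= (bigD1 p) //=.
  rewrite -addrA lerDl addr_ge0 //.
    by apply: sumr_ge0 => r _; rewrite exprn_ge0.
  by apply: sumr_ge0 => r _; apply: sumr_ge0 => s _; rewrite exprn_ge0.
apply: (@le_trans _ _ (`|rn_root x i k| ^+ 2 + `|rn_root x l j| ^+ 2)); last first.
  by rewrite mulr_natl mulr2n lerD.
apply: (@le_trans _ _ (2 * (`|rn_root x i k| * `|rn_root x l j|))).
  by rewrite ler_peMl ?mulr_ge0 // ler1n.
rewrite -subr_ge0 mulr_natl addrAC -sqrrB -realEsqr realB //.
Qed.

Lemma sandwich_entry_le (psi : X -> 'M[C]_d) (c : C) x i j :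
  (forall k l, `|psi x k l| <= c) ->
  `|sandwich psi x i j| <= d%:R * (d%:R * (c * 2)) * \tr (h x).
Proof.
move=> psic; have c0 : 0 <= c.
  exact: le_trans (normr_ge0 _) (psic (Ordinal povm_dim_gt0) (Ordinal povm_dim_gt0)).
have sumc (F : 'I_d -> C) b : (forall k, `|F k| <= b) -> `|\sum_k F k| <= d%:R * b.
  move=> Fb; apply: le_trans (ler_norm_sum _ _ _) _.
  apply: le_trans (ler_sum _ (fun k _ => Fb k)) _.
  by rewrite sumr_const card_ord mulr_natl.
rewrite -!mulrA mxE; apply: (sumc) => l; rewrite mxE mulr_suml; apply: sumc => k.
rewrite !normrM mulrAC mulrC; apply: ler_pM.
- exact: normr_ge0.
- by rewrite mulr_ge0.
- exact: psic.
- exact: rn_root_entry_le.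
Qed.

Lemma cintegrable_derivative_tr : cintegrable mu setT (fun x => \tr (h x)).
Proof.
have [_ _ ih _] := RNh.
have [+ _] := mintegral_tr mT 1%:M ih.
by under eq_fun do rewrite mul1mx.
Qed.

(** The integrand is dominated by a multiple of the trace of the derivative,
    which is integrable; the derivative itself need not be bounded. *)
Lemma nu_integrable_bounded (psi : X -> 'M[C]_d) (c : C) :
  mmeasurable (psi : borel X -> _) -> (forall x k l, `|psi x k l| <= c) ->
  nu_integrable nu h psi.
Proof.
move=> mpsi psic; apply/nu_integrableP; split=> // i j.
have [mRe mIm] := mmeasurable_sandwich mpsi i j.
pose b : C := d%:R * (d%:R * (c * 2)).
have [[idom _] _] := cintegrable_lin mT b cintegrable_derivative_tr
  (proj1 (cintegrable0 mu setT)).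
have le_dom x (r : R) : `|r|%:C <= `|sandwich psi x i j| ->
    `|r| <= `|Re (b * \tr (h x) + 0)|.
  move=> rle; rewrite addr0 -lecR; apply: le_trans rle _.
  apply: le_trans (sandwich_entry_le i j (psic x)) _; rewrite -/b.
  have b0 : 0 <= b * \tr (h x).
    exact: le_trans (normr_ge0 _) (sandwich_entry_le i j (psic x)).
  rewrite ger0_norm; first by rewrite RRe_real // ger0_real.
  by move: b0; rewrite lecE => /andP[].
split.
  apply: (@le_integrable _ (borel X) _ mu _ mT _ _ _ _ idom).
    exact/measurable_EFinP.
  by move=> x _; rewrite /= lee_fin; apply: le_dom; exact: normc_ge_Re.
apply: (@le_integrable _ (borel X) _ mu _ mT _ _ _ _ idom).
  exact/measurable_EFinP.
by move=> x _; rewrite /= lee_fin; apply: le_dom; exact: normc_ge_Im.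
Qed.

Lemma nu_integrable_cst (z : 'M[C]_d) : nu_integrable nu h (fun=> z).
Proof.
apply: (@nu_integrable_bounded _ (\sum_k \sum_l `|z k l|)) => [|x k l].
  exact: mmeasurable_cst.
rewrite (bigD1 k) //= (bigD1 l) //= -addrA lerDl addr_ge0 //.
  exact: sumr_ge0.
by apply: sumr_ge0 => ? _; exact: sumr_ge0.
Qed.

Lemma quantum_expectation_cst1 :
  quantum_expectation nu h (fun=> 1%:M) = nu setT.
Proof.
have [_ _ _ hE] := RNh.
rewrite quantum_expectationE; last exact: nu_integrable_cst.
rewrite (hE _ mT); apply/matrixP => i j; rewrite !mxE.
by congr cintegral; apply/funext => x; rewrite /sandwich mulmx1 rn_root_sqr.
Qed.

(** Finitely many expectations are given by one common finite sum, with points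
    in any prescribed set of full measure: the vector of all real and imaginary
    parts of all entries is an integral, hence lies in the cone generated by
    the values of its integrand. *)
Lemma expectation_quadrature (I : finType) (psi : I -> X -> 'M[C]_d) (D : set X) :
  Borel_set D -> mu (~` D) = 0%E -> (forall i, nu_integrable nu h (psi i)) ->
  exists m (lam : 'I_m -> R) (x : 'I_m -> X),
  [/\ forall k, 0 <= lam k, forall k, D (x k) &
      forall i, quantum_expectation nu h (psi i) =
        \sum_k (lam k)%:C *: sandwich (psi i) (x k)].
Proof.
move=> mD D0 ipsi.
pose J : finType := (I * 'I_d * 'I_d * bool)%type.
pose f (p : J) (x : borel X) : R :=
  let: (i, r, s, b) := p in
  let z := sandwich (psi i) x r s in if b then Re z else Im z.
have fi p : mu.-integrable setT (EFin \o f p).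
  move: p => [[[i r] s] b]; have /nu_integrableP[_ /(_ r s)[]] := ipsi i.
  by case: b.
have fiD p : mu.-integrable D (EFin \o f p).
  exact: (@integrableS _ (borel X) _ mu _ _ _ mT mD (@subsetT _ D) (fi p)).
have [m [lam [x [lam0 Dx xE]]]] :=
  @integral_in_cone R _ (borel X) mu #|J| D (fun j => f (enum_val j)) mD
    (fun j => fiD (enum_val j)).
exists m, lam, x; split=> // i.
have fE p : \int[mu]_t f p t = \sum_k lam k * f p (x k).
  have := xE (enum_rank p); rewrite enum_rankK => <-.
  rewrite /Rintegral.
  rewrite (@negligible_integral _ (borel X) _ mu _ _ _ _ mT (fi p) D0).
    by rewrite setTD setCK.
  exact: measurableC.
rewrite quantum_expectationE //; apply/matrixP => r s; rewrite mxE summxE.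
apply/eqP; rewrite eq_complex /=; apply/andP; split; apply/eqP.
  rewrite (fE (i, r, s, true)) (raddf_sum (@complex.Re R)).
  by apply: eq_bigr => k _; rewrite mxE /= ReM mul0r subr0.
rewrite (fE (i, r, s, false)) (raddf_sum (@complex.Im R)).
by apply: eq_bigr => k _; rewrite mxE /= ImM mul0r addr0.
Qed.

Hypothesis nu1 : nu setT = 1%:M.

(** Absorbing the weights into the square roots turns the finite sum into a
    compression by operators whose squares add up to the identity. *)
Lemma expectation_kraus (I : finType) (psi : I -> X -> 'M[C]_d) (D : set X) :
  Borel_set D -> mu (~` D) = 0%E -> (forall i, nu_integrable nu h (psi i)) ->
  exists m (a : 'I_m -> 'M[C]_d) (x : 'I_m -> X),
  [/\ forall k, (a k)^t* = a k, \sum_k a k *m a k = 1%:M, forall k, D (x k),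
      forall i, quantum_expectation nu h (psi i) =
        \sum_k a k *m psi i (x k) *m a k &
      forall rho : 'M[C]_d, (forall x, rho *m h x = h x *m rho) ->
        forall k, rho *m a k = a k *m rho].
Proof.
move=> mD D0 ipsi; pose psi1 (o : option I) := if o is Some i then psi i else fun=> 1%:M.
have ipsi1 o : nu_integrable nu h (psi1 o).
  by case: o => [i|] /=; [exact: ipsi|exact: nu_integrable_cst].
have [m [lam [x [lam0 Dx xE]]]] := expectation_quadrature mD D0 ipsi1.
pose a k := (Num.sqrt (lam k))%:C *: rn_root (x k).
have aE k (z : 'M[C]_d) : (lam k)%:C *: (rn_root (x k) *m z *m rn_root (x k)) =
    a k *m z *m a k.
  rewrite /a -!scalemxAl -scalemxAr scalerA -rmorphM -expr2 sqr_sqrtr //.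
exists m, a, x; split=> //.
- by move=> k; rewrite /a adjmxZ rn_root_adj conj_Creal // complex_real.
- rewrite -nu1 -quantum_expectation_cst1 (xE None); apply: eq_bigr => k _.
  by rewrite /sandwich aE mulmx1.
- by move=> i; rewrite (xE (Some i)); apply: eq_bigr => k _; rewrite -aE.
- move=> rho rhoh k; rewrite /a -scalemxAl -scalemxAr; congr (_ *: _).
  exact: (sqrtmx_comm (derivative_psd _) (rhoh _)).
Qed.

End QuantumExpectation.

(** * Spectral bounds and operator convex functions *)

Section SpectralBounds.
Variable R : realType.
Local Notation C := R[i].

(** The spectral bounds as operator inequalities, which survive compression. *)
Lemma spectrum_in_psd n (A : 'M[C]_n) (alpha beta : R) : A \is hermsymmx ->
  spectrum_in A [set` `[alpha, beta]] ->
  psdmx (A - alpha%:C%:M) /\ psdmx (beta%:C%:M - A).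
Proof.
move=> hA sA; have sAj j : alpha <= spectrum A j <= beta.
  by have := spectrum_inP hA sA j; rewrite /= in_itv.
have eA (r s : R) : r%:C *: A + s%:C%:M = fcalc (fun t => r * t + s) A.
  rewrite -fcalcD fcalc_cst; congr (_ + _); rewrite -fcalcM fcalc_cst.
  by rewrite mul_scalar_mx; congr (_ *: _); exact/esym/fcalc_id.
split.
  have -> : A - alpha%:C%:M = 1%:C *: A + (- alpha)%:C%:M.
    by rewrite scale1r rmorphN raddfN.
  rewrite eA; apply: psdmx_fcalc => j; rewrite mul1r subr_ge0.
  by have /andP[] := sAj j.
have -> : beta%:C%:M - A = (- 1)%:C *: A + beta%:C%:M.
  by rewrite rmorphN scaleN1r addrC.
rewrite eA; apply: psdmx_fcalc => j; rewrite mulN1r addrC subr_ge0.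
by have /andP[] := sAj j.
Qed.

Lemma psd_spectrum_in n (A : 'M[C]_n) (alpha beta : R) :
  psdmx (A - alpha%:C%:M) -> psdmx (beta%:C%:M - A) ->
  spectrum_in A [set` `[alpha, beta]].
Proof.
move=> Aa Ab z /eigenvalueP[v vA v0].
have v1 : 0 < (v *m v^t*) 0 0.
  by rewrite -dotmxE; exact: dotmx_is_dotmx.
have aE : (v *m (A - alpha%:C%:M) *m v^t*) 0 0 = (z - alpha%:C) * (v *m v^t*) 0 0.
  by rewrite mulmxBr vA mul_mx_scalar -scalerBl -scalemxAl mxE.
have bE : (v *m (beta%:C%:M - A) *m v^t*) 0 0 = (beta%:C - z) * (v *m v^t*) 0 0.
  by rewrite mulmxBr vA mul_mx_scalar -scalerBl -scalemxAl mxE.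
have := Aa (v^t*); rewrite trmxCK aE pmulr_lge0 // subr_ge0 => az.
have := Ab (v^t*); rewrite trmxCK bE pmulr_lge0 // subr_ge0 => zb.
move: az zb; rewrite !lecE /= => /andP[/eqP z0 az] /andP[_ zb].
exists (complex.Re z); first by rewrite /= in_itv /= az zb.
by apply/eqP; rewrite eq_complex /= eqxx z0 /=.
Qed.

Lemma unitary_entry_le1 n (P : 'M[C]_n) i j : P \is unitarymx -> `|P i j| <= 1.
Proof.
move=> /unitarymxP /matrixP /(_ i i); rewrite !mxE eqxx mulr1n (bigD1 j) //= => PE.
rewrite -(@expr_le1 _ 2) //; move: PE; rewrite !mxE -normCK => <-.
rewrite lerDl; apply: sumr_ge0 => k _.
by rewrite !mxE mul_conjC_ge0.
Qed.

Lemma fcalc_entry_le n (g : R -> R) (A : 'M[C]_n) (r : R) i j :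
  (forall k, `|g (spectrum A k)| <= r) -> `|fcalc g A i j| <= n%:R * r%:C.
Proof.
move=> gr; rewrite fcalc_entry; apply: le_trans (ler_norm_sum _ _ _) _.
have le1 k : `|(g (spectrum A k))%:C * ((spectralmx A k i)^* * spectralmx A k j)|
    <= r%:C.
  rewrite !normrM norm_conjC -[r%:C]mulr1; apply: ler_pM => //.
    by rewrite normc_def /= expr0n addr0 sqrtr_sqr lecR.
  rewrite -[X in _ <= X]mulr1; apply: ler_pM => //;
    exact/unitary_entry_le1/spectral_unitarymx.
apply: le_trans (ler_sum _ (fun k _ => le1 k)) _.
by rewrite sumr_const card_ord mulr_natl.
Qed.

Lemma fcalc_scalar1 (g : R -> R) (r : R) :
  fcalc g (r%:C%:M : 'M[C]_1) = (g r)%:C%:M.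
Proof.
have hr : (r%:C%:M : 'M[C]_1) \is hermsymmx.
  apply/hermsymmxP; rewrite tr_scalar_mx map_scalar_mx /=.
  by rewrite conj_Creal // complex_real.
have dE (s : R) : real_diag (fun=> s) = s%:C%:M :> 'M[C]_1.
  by apply/matrixP => i j; rewrite !ord1 !mxE.
have := @fcalc_eigen _ g _ _ (r%:C%:M : 'M[C]_1) 1%:M (fun=> r) hr.
by rewrite dE !mul1mx mulmx1 => /(_ erefl) ->; rewrite dE mulmx1.
Qed.

End SpectralBounds.

Section ConvexFunction.
Variables (R : realType) (J : set R) (theta : R -> R).
Hypothesis convex_theta : operator_convex J theta.
Local Notation C := R[i].

(** The case of matrices of size one. *)
Lemma operator_convex_convex (t x y : R) : 0 <= t <= 1 -> J x -> J y ->
  theta ((1 - t) * x + t * y) <= (1 - t) * theta x + t * theta y.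
Proof.
move=> t01 Jx Jy; have herm (r : R) : (r%:C%:M : 'M[C]_1) \is hermsymmx.
  apply/hermsymmxP; rewrite tr_scalar_mx map_scalar_mx /=.
  by rewrite conj_Creal // complex_real.
have spec (r : R) : J r -> spectrum_in (r%:C%:M : 'M[C]_1) J.
  move=> Jr z /eigenvalueP[v vr v0]; exists r => //; apply/eqP.
  move: vr; rewrite mul_mx_scalar => /eqP; rewrite -subr_eq0 -scalerBl.
  by rewrite scaler_eq0 (negbTE v0) orbF subr_eq0 eq_sym.
have := convex_theta t01 (herm x) (herm y) (spec x Jx) (spec y Jy).
rewrite !scale_scalar_mx -!raddfD -!rmorphM -!rmorphD !fcalc_scalar1.
rewrite !scale_scalar_mx -raddfD -!rmorphM -rmorphD.
move=> /(_ 1%:M); rewrite adjmx1 mul1mx mulmx1 -raddfB -rmorphB !mxE eqxx mulr1n.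
by rewrite ler0c subr_ge0.
Qed.

Lemma convex_between (c x y z : R) : J x -> J y -> x <= z <= y ->
  theta x <= c -> theta y <= c -> theta z <= c.
Proof.
move=> Jx Jy /andP[xz zy] xc yc.
have [xy|xy] := eqVneq x y.
  suff -> : z = x by [].
  by apply/eqP; rewrite eq_le xz {1}xy zy.
have xy0 : 0 < y - x by rewrite subr_gt0 lt_neqAle xy (le_trans xz).
pose t := (z - x) / (y - x).
have t0 : 0 <= t by rewrite divr_ge0 ?subr_ge0 // (le_trans xz).
have t1 : t <= 1 by rewrite ler_pdivrMr // mul1r lerD2r.
have -> : z = (1 - t) * x + t * y.
  rewrite mulrBl mul1r -addrA -mulrN -mulrDr [- x + y]addrC /t mulfVK ?gt_eqF //.
  by rewrite addrC subrK.
apply: le_trans (operator_convex_convex _ Jx Jy) _; first by rewrite t0 t1.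
have -> : c = (1 - t) * c + t * c by rewrite -mulrDl subrK mul1r.
by rewrite lerD // ler_wpM2l // subr_ge0.
Qed.

Variables alpha beta : R.
Hypothesis abJ : [set` `[alpha, beta]] `<=` J.

(** The endpoints bound the function above; the reflection about the midpoint m
    turns this into a lower bound through the value at m. *)
Lemma convex_bounded : exists M, forall t, alpha <= t <= beta -> `|theta t| <= M.
Proof.
pose U := Num.max (theta alpha) (theta beta).
pose m := (1 - 2^-1) * alpha + 2^-1 * beta.
have inJ t : alpha <= t <= beta -> J t by move=> tab; apply: abJ; rewrite /= in_itv.
have up t : alpha <= t <= beta -> theta t <= U.
  move=> tab; have /andP[at_ tb] := tab.
  have ab := le_trans at_ tb.
  have Ja : J alpha by apply: inJ; rewrite lexx ab.
  have Jb : J beta by apply: inJ; rewrite lexx ab.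
  by apply: (convex_between Ja Jb tab); rewrite /U le_max lexx ?orbT.
exists (`|U| + `|theta m| + `|theta m|) => t tab.
have rab : alpha <= alpha + beta - t <= beta.
  have /andP[at_ tb] := tab.
  by rewrite -addrA lerDl subr_ge0 tb addrA lerBlDr addrC lerD2l at_.
have half : 0 <= (2^-1 : R) <= 1 by rewrite invr_ge0 ler0n invf_le1 ?ler1n.
have := operator_convex_convex half (inJ _ tab) (inJ _ rab).
have -> : (1 - 2^-1) * t + 2^-1 * (alpha + beta - t) = m.
  rewrite /m; have -> : 1 - 2^-1 = 2^-1 :> R by rewrite [X in X - _](splitr 1) mul1r addrK.
  by rewrite -!mulrDr addrC subrK.
have -> : 1 - 2^-1 = 2^-1 :> R by rewrite [X in X - _](splitr 1) mul1r addrK.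
move=> low.
have uE := le_trans (up _ tab) (ler_norm _).
have uE' := le_trans (up _ rab) (ler_norm _).
have n1 : - `|theta m| <= theta m by rewrite lerNl -normrN ler_norm.
have n2 := normr_ge0 (theta m).
by rewrite ler_norml; apply/andP; split; lra.
Qed.

(** Sublevel sets are intervals. *)
Lemma convex_measurable :
  measurable_fun setT (theta \_ [set` `[alpha, beta]] : R -> R).
Proof.
apply: (proj1 (measurable_restrictT theta _)); first exact: measurable_itv.
apply: (measurability _ (RGenInftyO.measurableE R)).
have inab (t : R) : [set` `[alpha, beta]] t <-> alpha <= t <= beta.
  by rewrite /= in_itv.
move=> _ [_ [c ->] <-]; apply: is_interval_measurable.
move=> x y [xab xc] [yab yc] z xzy; split.
  apply/inab; have /inab/andP[ax _] := xab; have /inab/andP[_ yb] := yab.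
  by have /andP[xz zy] := xzy; rewrite (le_trans ax) // (le_trans zy).
have {}xc : theta x < c by move: xc; rewrite /= in_itv.
have {}yc : theta y < c by move: yc; rewrite /= in_itv.
rewrite /= in_itv /=.
apply: (@le_lt_trans _ _ (Num.max (theta x) (theta y))).
  by apply: (convex_between (abJ xab) (abJ yab) xzy); rewrite le_max lexx ?orbT.
by rewrite gt_max xc yc.
Qed.

End ConvexFunction.

(** * Properties of the quantum expectation *)

Section ExpectationProperties.
Variables (R : realType) (d : nat) (X : ptopologicalType).
Local Notation C := R[i].
Local Notation Re := complex.Re.
Local Notation Im := complex.Im.
Variables (nu : povm R d X) (h : X -> 'M[C]_d).
Hypothesis RNh : is_RN_derivative nu h.
Hypothesis nu1 : nu setT = 1%:M.
Local Notation mu := (trace_measure nu).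
Local Notation E := (quantum_expectation nu h).

Let mT : Borel_set [set: X] := @measurableT _ (borel X).

Let muT0 : mu (~` setT) = 0%E.
Proof. by rewrite setCT measure0. Qed.

Lemma expectation_kraus_setT (I : finType) (psi : I -> X -> 'M[C]_d) :
  (forall i, nu_integrable nu h (psi i)) ->
  exists m (a : 'I_m -> 'M[C]_d) (x : 'I_m -> X),
  [/\ forall k, (a k)^t* = a k, \sum_k a k *m a k = 1%:M,
      forall i, E (psi i) = \sum_k a k *m psi i (x k) *m a k &
      forall rho : 'M[C]_d, (forall x, rho *m h x = h x *m rho) ->
        forall k, rho *m a k = a k *m rho].
Proof.
move=> ipsi.
have [m [a [x [aa a1 _ aE acomm]]]] := expectation_kraus RNh nu1 mT muT0 ipsi.
by exists m, a, x.
Qed.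

(** A matrix that commutes with the derivative commutes with its square root,
    and so comes out of the integrand. *)
Lemma nu_integrable_linear (psi1 psi2 : X -> 'M[C]_d) (rho1 rho2 : 'M[C]_d) :
  nu_integrable nu h psi1 -> nu_integrable nu h psi2 ->
  (forall x, rho1 *m h x = h x *m rho1) ->
  (forall x, rho2 *m h x = h x *m rho2) ->
  nu_integrable nu h (fun x => rho1 *m psi1 x + rho2 *m psi2 x).
Proof.
move=> /nu_integrableP[m1 i1] /nu_integrableP[m2 i2] c1 c2.
apply/nu_integrableP; split.
  by apply: mmeasurableD; apply: mmeasurableM => //; exact: mmeasurable_cst.
have comm rho psi x : (forall x, rho *m h x = h x *m rho) ->
    rn_root h x *m (rho *m psi x) *m rn_root h x = rho *m sandwich h psi x.
  move=> rhoh.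
  have : rn_root h x *m rho = rho *m rn_root h x.
    exact: esym (sqrtmx_comm (derivative_psd RNh x) (rhoh x)).
  by rewrite /sandwich; move: (rn_root h x) => r rr; rewrite !mulmxA rr.
have ient (psi : X -> 'M[C]_d) (rho : 'M[C]_d) i j :
    (forall i j, cintegrable mu setT (fun x => sandwich h psi x i j)) ->
    cintegrable mu setT (fun x => (rho *m sandwich h psi x) i j).
  move=> ipsi; have [+ _] := mintegral_tr mT (delta_mx j i *m rho) ipsi.
  apply: eq_cintegrable => x.
  by move: (sandwich h psi x) => s; rewrite -mulmxA mxtrace_delta.
move=> i j; have [+ _] := cintegrable_lin mT 1 (ient _ rho1 i j i1) (ient _ rho2 i j i2).
apply: eq_cintegrable => x.
by rewrite /sandwich mulmxDr mulmxDl !comm // mul1r [RHS]mxE.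
Qed.

Lemma expectation_linear (psi1 psi2 : X -> 'M[C]_d) (rho1 rho2 : 'M[C]_d) :
  nu_integrable nu h psi1 -> nu_integrable nu h psi2 ->
  (forall x, rho1 *m h x = h x *m rho1) ->
  (forall x, rho2 *m h x = h x *m rho2) ->
  E (fun x => rho1 *m psi1 x + rho2 *m psi2 x) = rho1 *m E psi1 + rho2 *m E psi2.
Proof.
move=> i1 i2 c1 c2; have i3 := nu_integrable_linear i1 i2 c1 c2.
pose F (o : option bool) := match o with
  | Some true => psi1 | Some false => psi2
  | None => fun x => rho1 *m psi1 x + rho2 *m psi2 x end.
have [] := @expectation_kraus_setT _ F; first by case=> [[]|].
move=> m [a [x [_ _ aE acomm]]].
rewrite (aE None) (aE (Some true)) (aE (Some false)) !mulmx_sumr -big_split /=.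
apply: eq_bigr => k _; rewrite mulmxDr mulmxDl !mulmxA.
by rewrite -(acomm _ c1) -(acomm _ c2).
Qed.

(** The quadrature points are taken where the values are positive. *)
Lemma expectation_psd (psi : X -> 'M[C]_d) : nu_integrable nu h psi ->
  {ae mu, forall x, psdmx (psi x)} -> psdmx (E psi).
Proof.
move=> ipsi [N [mN N0 psiN]].
have mN' : Borel_set (~` N) := @measurableC _ (borel X) N mN.
have N'0 : mu (~` ~` N) = 0%E by rewrite setCK.
have [m [a [x [aa _ Dx aE _]]]] :=
  expectation_kraus RNh nu1 mN' N'0 (fun _ : unit => ipsi).
rewrite (aE tt); apply: psdmx_sum => k; rewrite -{1}[a k]aa.
apply: psdmx_congr; apply: contrapT => npsd.
by apply: (Dx k); apply: psiN.
Qed.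

Lemma indic_complex (A : set X) x : \1_A x = (\1_A x)%:C :> C.
Proof. by rewrite !indicE rmorph_nat. Qed.

Lemma sandwich_indic (A : set X) psi x :
  sandwich h (fun x => \1_A x *: psi x) x = \1_A x *: sandwich h psi x.
Proof. by rewrite /sandwich -scalemxAr -scalemxAl. Qed.

Lemma nu_integrable_indic (A : set X) (psi : X -> 'M[C]_d) : Borel_set A ->
  nu_integrable nu h psi -> nu_integrable nu h (fun x => \1_A x *: psi x).
Proof.
move=> mA /nu_integrableP[mpsi ipsi]; apply/nu_integrableP.
have mind : @cmeasurable _ (borel X) R (fun x => \1_A x).
  under eq_fun do rewrite indic_complex.
  by apply: cmeasurable_real; exact/measurable_indicP.
have mpsiA : @mmeasurable _ (borel X) R _ _ (fun x => \1_A x *: psi x).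
  exact: mmeasurableZ.
split=> // i j; have [mRe mIm] := mmeasurable_sandwich RNh mpsiA i j.
have [iRe iIm] := ipsi i j.
have le_ind (r : R) x : `|\1_A x * r| <= `|r|.
  by rewrite normrM indicE ler_piMl // ger0_norm // lern1; case: (x \in A).
split.
  apply: (@le_integrable _ (borel X) _ mu _ mT _ _ _ _ iRe).
    exact/measurable_EFinP.
  move=> x _; rewrite /= lee_fin sandwich_indic mxE indic_complex ReM mul0r subr0.
  exact: le_ind.
apply: (@le_integrable _ (borel X) _ mu _ mT _ _ _ _ iIm).
  exact/measurable_EFinP.
move=> x _; rewrite /= lee_fin sandwich_indic mxE indic_complex ImM mul0r addr0.
exact: le_ind.
Qed.

Lemma expectation_additive (A B : set X) (psi : X -> 'M[C]_d) :
  Borel_set A -> Borel_set B -> A `&` B = set0 -> nu_integrable nu h psi ->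
  E (fun x => \1_(A `|` B) x *: psi x) =
  E (fun x => \1_A x *: psi x) + E (fun x => \1_B x *: psi x).
Proof.
move=> mA mB AB ipsi; pose F (o : option bool) := match o with
  | Some true => A | Some false => B | None => A `|` B end.
have mAB : Borel_set (A `|` B) := @measurableU _ (borel X) A B mA mB.
have [] := @expectation_kraus_setT _ (fun o x => \1_(F o) x *: psi x).
  by move=> o; apply: nu_integrable_indic => //; case: o => [[]|].
move=> m [a [x [_ _ aE _]]].
rewrite (aE None) (aE (Some true)) (aE (Some false)) -big_split /=.
apply: eq_bigr => k _; rewrite -mulmxDl -mulmxDr -scalerDl.
congr (_ *m (_ *: _) *m _); rewrite !indicE in_setU -natrD.
case: (boolP (x k \in A)) => // xA; case: (boolP (x k \in B)) => // xB.
suff : (A `&` B) (x k) by rewrite AB.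
by split; rewrite -inE.
Qed.

Lemma expectation_indic1 (A : set X) : Borel_set A ->
  E (fun x => \1_A x *: 1%:M) = nu A.
Proof.
move=> mA; have i1 := nu_integrable_indic mA (nu_integrable_cst RNh 1%:M).
have [_ _ _ hE] := RNh.
rewrite (quantum_expectationE i1) (hE _ mA); apply/matrixP => i j.
rewrite !mxE.
have sE x : sandwich h (fun x => \1_A x *: 1%:M) x i j = (\1_A x)%:C * h x i j.
  rewrite sandwich_indic mxE -indic_complex; congr (_ * _).
  by rewrite /sandwich mulmx1 (rn_root_sqr RNh).
under eq_fun do rewrite sE.
rewrite /cintegral; congr (_ +i* _); rewrite [RHS]Rintegral_mkcond;
    apply: eq_Rintegral => x _; rewrite patchE.
  by rewrite ReM mul0r subr0 indicE; case: ifP => _; rewrite (mul1r, mul0r).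
by rewrite ImM mul0r addr0 indicE; case: ifP => _; rewrite (mul1r, mul0r).
Qed.

(** All points of a quadrature supported on the range of [x] are among the
    [x j]; grouping them by [j], the weights at [x j] add up to [nu [set x j]]. *)
Lemma expectation_finite_support n (x : 'I_n -> X) (psi : X -> 'M[C]_d) :
  hausdorff_space X -> injective x -> nu (~` range x) = 0 ->
  nu_integrable nu h psi ->
  E psi = \sum_j sqrtmx (nu [set x j]) *m psi (x j) *m sqrtmx (nu [set x j]).
Proof.
move=> hX injx nux ipsi.
have mx j : Borel_set [set x j].
  rewrite -[[set x j]]setCK; apply: (@measurableC _ (borel X)).
  apply: sub_sigma_algebra; apply: closed_openC.
  exact/accessible_closed_set1/hausdorff_accessible.
have mD : Borel_set (range x).
  have -> : range x = \bigcup_(j in [set: 'I_n]) [set x j].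
    apply/seteqP; split => [_ [j _ <-]|y [j _ ->]]; first by exists j.
    by exists j.
  apply: (@fin_bigcup_measurable _ (borel X)) => // j _; exact: mx.
have D0 : mu (~` range x) = 0%E.
  rewrite /= /trace_measure asboolT; last exact: (@measurableC _ (borel X)).
  by rewrite nux mxtrace0 mulr0.
pose F (o : option 'I_n) y : 'M[C]_d := match o with
  | None => psi y | Some j => \1_[set x j] y *: 1%:M end.
have iF o : nu_integrable nu h (F o).
  case: o => [j|] //=; apply: nu_integrable_indic; first exact: mx.
  exact: (nu_integrable_cst RNh).
have [m [lam [y [lam0 Dy yE]]]] := expectation_quadrature mD D0 iF.
have /fin_all_exists[s sE] : forall k, exists j : 'I_n, x j = y k.
  by move=> k; have [j _ xj] := Dy k; exists j.
pose L j := \sum_(k | s k == j) lam k.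
have L0 j : 0 <= L j by exact: sumr_ge0.
have nuE j : nu [set x j] = (L j)%:C *: h (x j).
  rewrite -expectation_indic1 // (yE (Some j)) rmorph_sum scaler_suml.
  rewrite [RHS]big_mkcond; apply: eq_bigr => k _ /=.
  rewrite sandwich_indic /sandwich mulmx1 (rn_root_sqr RNh) -sE indicE.
  have -> : (x (s k) \in [set x j]) = (s k == j).
    by apply/idP/eqP => [|->]; rewrite inE // => /injx.
  by case: eqP => [->|_]; rewrite ?scale1r // scale0r scaler0.
rewrite (yE None) (partition_big s xpredT) //=; apply: eq_bigr => j _.
rewrite nuE sqrtmxZ //; last exact: (derivative_psd RNh).
rewrite -!scalemxAl -scalemxAr scalerA -rmorphM -expr2 sqr_sqrtr //.
rewrite rmorph_sum scaler_suml; apply: eq_bigr => k /eqP <-.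
by rewrite -sE.
Qed.

(** * Continuous functions *)

Section Continuous.
Hypothesis compactX : compact [set: X].

Lemma continuous_entry (f : X -> 'M[C]_d) i j : continuous f ->
  continuous (fun x => f x i j).
Proof.
move=> cf x; have ce := @coord_continuous C d d i j (f x).
exact: (cvg_comp f (fun M : 'M[C]_d => M i j) (cf x) ce).
Qed.

Lemma continuous_bounded_real (g : X -> R) : continuous g ->
  exists M, forall x, `|g x| <= M.
Proof.
move=> cg; have : compact (g @` setT).
  by apply: continuous_compact => //; exact: continuous_subspaceT.
move=> /compact_bounded[M [_ MP]]; exists (M + 1) => x.
by apply: (MP (M + 1)) => //; rewrite ltrDl.
Qed.

(** Compactness bounds the entries. *)
Lemma nu_integrable_continuous (f : X -> 'M[C]_d) : continuous f ->
  nu_integrable nu h f.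
Proof.
move=> cf.
have cRe i j : continuous (fun x => Re (f x i j)).
  move=> x; have ck := @continuous_Re R (f x i j).
  exact: (cvg_comp (fun x => f x i j) _ (@continuous_entry f i j cf x) ck).
have cIm i j : continuous (fun x => Im (f x i j)).
  move=> x; have ck := @continuous_Im R (f x i j).
  exact: (cvg_comp (fun x => f x i j) _ (@continuous_entry f i j cf x) ck).
have /fin_all_exists[c cP] : forall p : 'I_d * 'I_d, exists c : C,
    forall x, `|f x p.1 p.2| <= c.
  move=> [i j].
  have [M1 P1] := continuous_bounded_real (cRe i j).
  have [M2 P2] := continuous_bounded_real (cIm i j).
  exists (M1 + M2)%:C => x; apply: le_trans (normc_le_ReIm _) _.
  by rewrite lecR lerD.
apply: (@nu_integrable_bounded _ _ _ _ _ RNh f (\sum_p c p)).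
  by move=> i j; split; exact: continuous_Borel.
move=> x k l; rewrite (bigD1 (k, l)) //=; apply: le_trans (cP (k, l) x) _.
rewrite lerDl; apply: sumr_ge0 => p _.
exact: le_trans (normr_ge0 _) (cP p x).
Qed.

(** One quadrature serves all entries of a block matrix of functions. *)
Lemma expectation_cp : completely_positive_on_C (X := X) E.
Proof.
move=> k F cF F0; pose G (p : 'I_k * 'I_k) := F p.1 p.2.
have [m [a [x [aa _ aE _]]]] :=
  expectation_kraus_setT (fun p : 'I_k * 'I_k => nu_integrable_continuous (cF p.1 p.2)).
apply/psdmx_blockP => v.
have -> : \sum_i \sum_j ((v i)^t* *m E (F i j) *m v j) 0 0 =
    \sum_l \sum_i \sum_j ((a l *m v i)^t* *m F i j (x l) *m (a l *m v j)) 0 0.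
  rewrite [RHS]exchange_big; apply: eq_bigr => i _ /=.
  rewrite [RHS]exchange_big; apply: eq_bigr => j _ /=.
  rewrite (aE (i, j)) mulmx_sumr mulmx_suml summxE; apply: eq_bigr => l _.
  by rewrite adjmxM aa !mulmxA.
apply: sumr_ge0 => l _.
by have /psdmx_blockP/(_ (fun i => a l *m v i)) := F0 (x l).
Qed.

End Continuous.

Lemma expectation_scale (c : C) (f g : X -> 'M[C]_d) :
  nu_integrable nu h f -> nu_integrable nu h g ->
  E (fun x => c *: f x + g x) = c *: E f + E g.
Proof.
move=> fi gi.
have -> : (fun x => c *: f x + g x) = (fun x => c%:M *m f x + 1%:M *m g x).
  by apply/funext => x; rewrite !mul_scalar_mx scale1r.
have c1 x : c%:M *m h x = h x *m c%:M by rewrite mul_scalar_mx mul_mx_scalar.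
have c2 x : 1%:M *m h x = h x *m 1%:M by rewrite mulmx1 mul1mx.
by rewrite (expectation_linear fi gi c1 c2) !mul_scalar_mx scale1r.
Qed.

(** * Jensen's inequality for the quantum expectation *)

(** One quadrature serves both sides, which become the two sides of the
    inequality for finite families. *)
Lemma expectation_jensen (J : set R) (alpha beta : R) (psi : X -> 'M[C]_d)
    (theta : R -> R) :
  [set` `[alpha, beta]] `<=` J ->
  (forall x, psi x \is hermsymmx /\ spectrum_in (psi x) [set` `[alpha, beta]]) ->
  operator_convex J theta -> nu_integrable nu h psi ->
  [/\ nu_integrable nu h (fun x => fcalc theta (psi x)),
      E psi \is hermsymmx, spectrum_in (E psi) J &
      loewner (fcalc theta (E psi)) (E (fun x => fcalc theta (psi x)))].
Proof.
move=> abJ psiab cvx ipsi.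
have hpsi x : psi x \is hermsymmx by have [] := psiab x.
have spsi x : spectrum_in (psi x) [set` `[alpha, beta]] by have [] := psiab x.
have speck x k : alpha <= spectrum (psi x) k <= beta.
  by have := spectrum_inP (hpsi x) (spsi x) k; rewrite /= in_itv.
have ifpsi : nu_integrable nu h (fun x => fcalc theta (psi x)).
  have [M MP] := convex_bounded cvx abJ.
  apply: (@nu_integrable_bounded _ _ _ _ _ RNh _ (d%:R * M%:C)).
    pose g := theta \_ [set` `[alpha, beta]].
    have -> : (fun x => fcalc theta (psi x)) = (fun x => fcalc g (psi x)).
      apply/funext => x; apply: eq_fcalc => k; rewrite /g patchE mem_set //.
      by rewrite /= in_itv; exact: speck.
    have /nu_integrableP[mpsi _] := ipsi.
    by apply: (fcalc_measurable_Borel (convex_measurable cvx abJ)).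
  by move=> x k l; apply: fcalc_entry_le => j; exact: MP.
have [] := @expectation_kraus_setT bool
  (fun b => if b then psi else fun x => fcalc theta (psi x)); first by case.
move=> m [a [x [aa a1 aE _]]].
have aE1 : E psi = \sum_k (a k)^t* *m psi (x k) *m a k.
  by rewrite (aE true); apply: eq_bigr => k _; rewrite aa.
have aE2 : E (fun x => fcalc theta (psi x)) =
    \sum_k (a k)^t* *m fcalc theta (psi (x k)) *m a k.
  by rewrite (aE false); apply: eq_bigr => k _; rewrite aa.
have a1' : \sum_k (a k)^t* *m a k = 1%:M.
  by rewrite -[RHS]a1; apply: eq_bigr => k _; rewrite aa.
have compress (r : R) : r%:C%:M = \sum_k (a k)^t* *m r%:C%:M *m a k.
  rewrite -[LHS]mulmx1 -a1' mulmx_sumr; apply: eq_bigr => k _.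
  by rewrite mul_scalar_mx mul_mx_scalar scalemxAl.
split=> //.
- rewrite aE1; apply/hermsymmxP; rewrite adjmx_sum; apply: eq_bigr => k _.
  by rewrite !adjmxM trmxCK (hermsymmxP _ (hpsi _)) mulmxA.
- have : spectrum_in (E psi) [set` `[alpha, beta]].
    apply: psd_spectrum_in.
      rewrite aE1 compress -sumrB; apply: psdmx_sum => k.
      rewrite -mulmxBl -mulmxBr; apply: psdmx_congr.
      exact: (proj1 (spectrum_in_psd (hpsi (x k)) (spsi (x k)))).
    rewrite aE1 compress -sumrB; apply: psdmx_sum => k.
    rewrite -mulmxBl -mulmxBr; apply: psdmx_congr.
    exact: (proj2 (spectrum_in_psd (hpsi (x k)) (spsi (x k)))).
  by move=> sE z /sE[t tab ->]; exists t => //; exact: abJ.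
- rewrite aE1 aE2; apply: (jensen_finite cvx) => // k.
  by move=> z /spsi[t tab ->]; exists t => //; exact: abJ.
Qed.

(** * The channel of constant functions *)

(** The quadrature common to all matrix units gives, by linearity, a Kraus
    decomposition of the whole channel. *)
Lemma channel_kraus : exists m (a : 'I_m -> 'M[C]_d),
  [/\ forall k, (a k)^t* = a k, \sum_k a k *m a k = 1%:M &
      channel nu h = kraus a].
Proof.
have chan_lin : linear (channel nu h).
  move=> c y z; exact: (expectation_scale c (nu_integrable_cst RNh y) (nu_integrable_cst RNh z)).
have [m [a [x [aa a1 aE _]]]] := expectation_kraus_setT
  (fun p : 'I_d * 'I_d => nu_integrable_cst RNh (delta_mx p.1 p.2)).
exists m, a; split=> //; apply/funext => z.
rewrite (linear_delta_expand chan_lin) (linear_delta_expand (kraus_is_linear a)).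
by apply: eq_bigr => p _; rewrite /channel (aE p).
Qed.

End ExpectationProperties.

Section KrausConsequences.
Variables (R : realType) (n K : nat) (a : 'I_K -> 'M[R[i]]_n).
Local Notation C := R[i].
Hypotheses (a_adj : forall k, (a k)^t* = a k).
Hypothesis (a_unit : \sum_k a k *m a k = 1%:M).

Lemma kraus_channel : unital_quantum_channel (kraus a).
Proof.
split; [exact: kraus_is_linear|exact: kraus_cp|exact: kraus_tr|exact: kraus1].
Qed.

Lemma kraus_state rho : state rho -> state (kraus a rho).
Proof.
move=> [rho0 rho1]; split; last by rewrite kraus_tr.
by apply: psdmx_sum => k; rewrite -{1}[a k]a_adj; exact: psdmx_congr.
Qed.

(** The fixed points form the commutant of the Kraus operators. *)
Lemma kraus_fixed_algebra : unital_Cstar_subalgebra [set z | kraus a z = z].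
Proof.
have fixP := kraus_fixedP a_adj a_unit.
split.
- exact: kraus1.
- by move=> c y z /= yfix zfix; rewrite linearP /= yfix zfix.
- move=> y z /= /fixP yc /fixP zc; apply/fixP => k.
  by rewrite mulmxA yc -mulmxA zc mulmxA.
- by move=> z /= zfix; rewrite -(kraus_adj a_adj) zfix.
- pose f (p : 'I_n * 'I_n) (z : 'M[C]_n) : C := (kraus a z - z) p.1 p.2.
  have -> : [set z | kraus a z = z] =
      \bigcap_(p in [set: 'I_n * 'I_n]) f p @^-1` [set 0].
    apply/seteqP; split => [z /= zfix p _|z zP] /=.
      by rewrite /f zfix subrr mxE.
    apply/eqP; rewrite -subr_eq0; apply/eqP/matrixP => i j.
    by rewrite [RHS]mxE; exact: (zP (i, j) I).
  have cf p : continuous (f p).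
    have f_lin : linear (fun y => kraus a y - y).
      by move=> c y z; rewrite linearP /= scalerBr opprD addrACA.
    rewrite (_ : f p = fun y => \sum_(q : 'I_n * 'I_n)
        y q.1 q.2 * f p (delta_mx q.1 q.2)); last first.
      apply/funext => y; rewrite /f (linear_delta_expand f_lin) summxE.
      by apply: eq_bigr => q _; rewrite mxE.
    move=> z; have Fz : Filter (nbhs z) := nbhs_filter z.
    apply: cvg_finsum => q; apply: cvgMr_tmp.
    exact: (@coord_continuous C).
  apply: closed_bigI => p _; apply: preimage_closed => [z _|]; first exact: cf.
  exact/accessible_closed_set1/hausdorff_accessible/norm_hausdorff.
Qed.

End KrausConsequences.

Theorem theoremI3 (R : realType) (d : nat) (X : ptopologicalType)
    (hausdorffX : hausdorff_space X) (compactX : compact [set: X])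
    (nu : povm R d X) (nu1 : nu setT = 1%:M)
    (h : X -> 'M[R[i]]_d) (RNh : is_RN_derivative nu h)
    (psi psi1 psi2 : X -> 'M[R[i]]_d)
    (ipsi : nu_integrable nu h psi)
    (ipsi1 : nu_integrable nu h psi1) (ipsi2 : nu_integrable nu h psi2) :
  (* (1) generalised linearity *)
  (forall rho1 rho2 : 'M[R[i]]_d,
     (forall x, rho1 *m h x = h x *m rho1) ->
     (forall x, rho2 *m h x = h x *m rho2) ->
     nu_integrable nu h (fun x => rho1 *m psi1 x + rho2 *m psi2 x) /\
     quantum_expectation nu h (fun x => rho1 *m psi1 x + rho2 *m psi2 x) =
       rho1 *m quantum_expectation nu h psi1
       + rho2 *m quantum_expectation nu h psi2) /\
  (* (2) monotonicity *)
  ({ae trace_measure nu, forall x, psdmx (psi x)} ->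
     psdmx (quantum_expectation nu h psi)) /\
  (* (3) additivity *)
  (forall E F : set X, Borel_set E -> Borel_set F -> E `&` F = set0 ->
     [/\ nu_integrable nu h (fun x => \1_(E `|` F) x *: psi x),
         nu_integrable nu h (fun x => \1_E x *: psi x),
         nu_integrable nu h (fun x => \1_F x *: psi x)
       & quantum_expectation nu h (fun x => \1_(E `|` F) x *: psi x) =
         quantum_expectation nu h (fun x => \1_E x *: psi x) +
         quantum_expectation nu h (fun x => \1_F x *: psi x)]) /\
  (* (4) finitely supported measures *)
  (forall (n : nat) (x : 'I_n -> X), injective x ->
     nu (~` range x) = 0 ->
     quantum_expectation nu h psi =
       \sum_(j < n) sqrtmx (nu [set x j]) *m psi (x j)
                    *m sqrtmx (nu [set x j])) /\
  (* (5) complete positivity *)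
  [/\ forall f : X -> 'M[R[i]]_d, continuous f -> nu_integrable nu h f,
      forall (c : R[i]) (f g : X -> 'M[R[i]]_d), continuous f -> continuous g ->
        quantum_expectation nu h (fun x => c *: f x + g x) =
        c *: quantum_expectation nu h f + quantum_expectation nu h g,
      quantum_expectation nu h (fun=> 1%:M) = 1%:M
    & completely_positive_on_C (X := X) (quantum_expectation nu h)] /\
  (* (6) Jensen's inequality *)
  (forall (J : set R) (alpha beta : R),
     is_interval J -> open J -> alpha <= beta -> [set` `[alpha, beta]] `<=` J ->
     (forall x, psi x \is hermsymmx /\
                spectrum_in (psi x) [set` `[alpha, beta]]) ->
     forall theta : R -> R, operator_convex J theta ->
     [/\ nu_integrable nu h (fun x => fcalc theta (psi x)),
         quantum_expectation nu h psi \is hermsymmx,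
         spectrum_in (quantum_expectation nu h psi) J
       & loewner (fcalc theta (quantum_expectation nu h psi))
                 (quantum_expectation nu h (fun x => fcalc theta (psi x)))]) /\
  (* (7) quantum quantum_expectation of constant functions *)
  [/\ forall z : 'M[R[i]]_d, nu_integrable nu h (fun=> z),
      unital_quantum_channel (channel nu h)
    & forall rho : 'M[R[i]]_d, state rho -> state (channel nu h rho)] /\
  (* (8) fixed points *)
  unital_Cstar_subalgebra (fixed_points nu h) /\
  (* (9) ergodic property *)
  (exists EE : 'M[R[i]]_d -> 'M[R[i]]_d,
     [/\ conditional_expectation EE,
         trace_preserving EE,
         range EE = fixed_points nu h
       & lin_mx (cesaro_mean (channel nu h) N) @[N --> \oo] --> lin_mx EE]).
Proof.
have [m [a [aa a1 chanE]]] := channel_kraus RNh nu1.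
have chan_fix : fixed_points nu h = [set z | kraus a z = z].
  by rewrite /fixed_points chanE.
split.
  move=> rho1 rho2 c1 c2; split; first exact: nu_integrable_linear.
  exact: expectation_linear.
split; first exact: expectation_psd.
split.
  move=> E F mE mF EF.
  have mEF : Borel_set (E `|` F) := @measurableU _ (borel X) E F mE mF.
  by split; [exact: nu_integrable_indic..|exact: expectation_additive].
split; first by move=> n x injx nux; exact: expectation_finite_support.
split.
  split.
  - by move=> f cf; exact: (nu_integrable_continuous RNh compactX).
  - move=> c f g cf cg; apply: (expectation_scale RNh nu1);
      exact: (nu_integrable_continuous RNh compactX).
  - by rewrite (quantum_expectation_cst1 RNh).
  - exact: expectation_cp.
split.
  move=> J alpha beta _ _ _ abJ psiab theta cvx.
  exact: (expectation_jensen RNh nu1 abJ psiab cvx ipsi).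
split.
  rewrite chanE; split; first exact: nu_integrable_cst.
  - exact: kraus_channel.
  - by move=> rho; exact: kraus_state.
split; first by rewrite chan_fix; exact: kraus_fixed_algebra.
exists (ergodic_projection a); rewrite chanE chan_fix; split.
- exact: ergodic_projection_expectation.
- by move=> z; exact: ergodic_projection_trace.
- exact: ergodic_projection_range.
- by apply: cvg_lin_mx => z i j; exact: ergodic_projection_cvg.
Qed.
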